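(* For each $n\in\mathbb{N}$ let $X_1,\ldots,X_n$ be independent random variables, each uniformly distributed on $\{1,\ldots,n\}$, and let $P_n$ be the law of $\frac{1}{n^{2}}\sum_{1\leq i,j\leq n}1_{\gcd(X_{i},X_{j})=1}$ on $[0,1]$. Then $(P_n)_{n\in\mathbb{N}}$ satisfies a large deviation principle (with speed $n$) with rate function \[ I_{1}(x)=\inf\left\{H(\mu\,|\,\nu):\ \mu\text{ a Borel probability measure on }[0,1],\ \iint_{[0,1]^{2}}f(u,v)\,\mu(du)\,\mu(dv)=x\right\}, \] with $\inf\emptyset=+\infty$.
   Context: Let $p_1<p_2<\cdots$ be the primes in increasing order. For $a\in[0,1]$ and $i\in\mathbb{N}$, $\chi_i(a)$ denotes the $i$-th digit of the binary expansion of $a$, where for numbers with two binary expansions the finite one is used. $\nu$ is the Borel probability measure on $[0,1]$ under which the digits $\chi_1,\chi_2,\ldots$ are independent and $\chi_i$ is Bernoulli with parameter $1/p_i$ (i.e. $\nu(\chi_i=1)=1/p_i$); equivalently $\nu$ is the weak limit of the measures $\nu_k$ with $\nu_k([0,b])=\sum_{i=1}^{k}\prod_{j=1}^{i-1}(1-1/p_j)\,(1-1/p_i)^{b_i}$, $b=0.b_1b_2\ldots$. The function $f:[0,1]^2\to\{0,1\}$ is $f(u,v)=1-\max_{i\in\mathbb{N}}\chi_i(u)\chi_i(v)$, i.e. $f(u,v)=1$ iff $u,v$ have no common digit $1$ at the same position of their binary expansions. $H(\mu|\nu)=\int\log\frac{d\mu}{d\nu}\,d\mu$ if $\mu\ll\nu$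 and $\log\frac{d\mu}{d\nu}\in L^1(\mu)$, and $+\infty$ otherwise. A sequence of probability measures $P_n$ on a topological space satisfies a large deviation principle with rate function $I$ if $I\ge0$ is lower semicontinuous and for every measurable $A$: $-\inf_{A^{o}}I\leq\liminf_n\frac1n\log P_n(A)\leq\limsup_n\frac1n\log P_n(A)\leq-\inf_{\overline{A}}I$. *)

(* Defs.v *)
From HB Require Import structures.
From mathcomp Require Import all_boot all_order all_algebra.
From mathcomp Require Import all_classical all_reals all_analysis.
Set Implicit Arguments. Unset Strict Implicit. Unset Printing Implicit Defensive.
Import Order.TTheory GRing.Theory Num.Theory.
Import numFieldNormedType.Exports.
Local Open Scope classical_set_scope.
Local Open Scope ring_scope.

Lemma next_prime_ex (m : nat) : exists p, (m < p)%N && prime p.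
Proof. by case: (prime_above m) => p h1 h2; exists p; rewrite h1 h2. Qed.

Definition next_prime (m : nat) : nat := ex_minn (next_prime_ex m).

(* nth_prime k = p_{k+1}  (so nth_prime 0 = 2, nth_prime 1 = 3, ...) *)
Definition nth_prime (k : nat) : nat := iter k.+1 next_prime 1%N.

Section Defs.
Variable R : realType.

Definition I01 : set R := [set x | 0 <= x <= 1].

(* binary digits: digit a k = chi_{k+1}(a), the (k+1)-th binary digit of a,
   the finite expansion being used for dyadic rationals; a = 1 has only the
   expansion 0.111..., so all its digits are 1. *)
Definition digit (a : R) (k : nat) : bool :=
  if a == 1 then true else odd `|Num.floor (a * 2 ^+ k.+1)|%N.

Definition fdig (u v : R) : R :=
  if `[< forall k, ~~ (digit u k && digit v k) >] then 1 else 0.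

(* nu: the Borel probability measure on [0,1] under which the digits are
   independent, chi_{k+1} being Bernoulli(1/p_{k+1}). *)
Definition is_prime_digit_measure (nu : probability R R) : Prop :=
  forall (k : nat) (b : nat -> bool),
    nu [set a | I01 a /\ forall i, (i < k)%N -> digit a i = b i] =
    (\prod_(i < k) (if b i then (nth_prime i)%:R^-1
                    else 1 - (nth_prime i)%:R^-1))%:E.

(* relative entropy H(mu|nu): integral of log (dmu/dnu) w.r.t. mu when mu has a
   density w.r.t. nu whose log is mu-integrable, +oo otherwise.  All densities
   agree nu-a.e. (hence mu-a.e.), so the infimum below is over a set that is
   either empty (value +oo) or a singleton. *)
Definition is_density (mu nu : probability R R) (g : R -> R) : Prop :=
  [/\ measurable_fun setT g, (forall x, 0 <= g x) &
      forall A, measurable A -> (mu A = \int[nu]_(x in A) (g x)%:E)%E].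

Definition rel_entropy (mu nu : probability R R) : \bar R :=
  ereal_inf [set (\int[mu]_x (ln (g x))%:E)%E | g in
    [set g | is_density mu nu g /\
             mu.-integrable setT (fun x => (ln (g x))%:E)]].

Definition rate_I1 (nu : probability R R) (x : R) : \bar R :=
  ereal_inf [set rel_entropy mu nu | mu in
    [set mu : probability R R | mu I01 = 1%E /\
       (\int[mu]_u \int[mu]_v (fdig u v)%:E)%E = x%:E]].

Definition coprime_stat (n : nat) (x : {ffun 'I_n -> 'I_n}) : R :=
  (\sum_(i < n) \sum_(j < n) (coprime (x i).+1 (x j).+1)%:R) / (n%:R ^+ 2).

(* P_n(A): law of the statistic when X_1..X_n are i.i.d. uniform on {1..n},
   i.e. the (X_i) are uniform on {1..n}^n *)
Definition Pn (n : nat) (A : set R) : R :=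
  (\sum_(x : {ffun 'I_n -> 'I_n}) (if `[< A (coprime_stat x) >] then 1 else 0))
  / (n%:R ^+ n).

Definition rel_interior (A : set R) : set R :=
  [set x | I01 x /\ exists e : R, 0 < e /\
     forall y, I01 y -> `|y - x| < e -> A y].
Definition rel_closure (A : set R) : set R :=
  [set x | I01 x /\ forall e : R, 0 < e ->
     exists y, [/\ I01 y, A y & `|y - x| < e]].

Definition elog (p : R) : \bar R := if p == 0 then -oo%E else (ln p)%:E.

(* large deviation principle with speed n on the space [0,1]
   for a sequence P_1, P_2, ... of laws (P n = P_n, n >= 1) *)
Definition LDP (P : nat -> set R -> R) (I : R -> \bar R) : Prop :=
  [/\ (forall x, I01 x -> (0 <= I x)%E),
      (forall t : R, closed [set x | I01 x /\ (I x <= t%:E)%E]) &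
      forall A : set R, measurable A -> A `<=` I01 ->
        (- ereal_inf (I @` rel_interior A)
           <= limn_einf (fun n => (n.+1%:R^-1)%:E * elog (P n.+1 A)))%E /\
        (limn_esup (fun n => (n.+1%:R^-1)%:E * elog (P n.+1 A))
           <= - ereal_inf (I @` rel_closure A))%E].

End Defs.

(* Main.v *)
(* The digits of X are the indicators of p_i | X, so two integers are coprime
   iff they share no digit 1.  Truncating to the first k digits turns the
   statistic into a continuous function of an empirical law on {0,1}^k, for
   which Sanov's theorem holds by counting types; the pairs sharing a divisor
   greater than k are superexponentially rare as k grows, because the pairs
   (i, t - i), i in Z/n, form for each t a matching of independent pairs.

   What remains is the semicontinuity of the rate function, obtained without
   weak compactness: a law on {0,1}^k of entropy at most t whose quadratic form
   is close to x is deformed at small cost into one attaining x exactly.  The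
   form is lowered by setting the first digit to 1 with a small probability, and
   raised by resampling the digits of index at least j from nu and moving a
   little mass to the points with first j digits 0.  The end points are apart:
   near x = 1 the entropy blows up because prod (1 - 1/p) diverges to 0, and near
   x = 0 it is at least ln 2, by a coupling of two copies of nu without common
   digits.  Extending laws on {0,1}^k by independent digits of nu multiplies the
   form by prod_(i >= k) (1 - 1/p_i^2) and preserves the entropy. *)
Require Import Defs.
From HB Require Import structures.
From mathcomp Require Import all_boot all_order all_algebra.
From mathcomp Require Import all_classical all_reals all_analysis.
From mathcomp Require Import measurable_realfun ring lra zify.
Import Order.TTheory GRing.Theory Num.Theory.
Import numFieldNormedType.Exports.
Set Implicit Arguments. Unset Strict Implicit. Unset Printing Implicit Defensive.
Local Open Scope classical_set_scope.
Local Open Scope ring_scope.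

(** * Primes and products over primes *)

(** The infimum in the rate runs over an exact level set of a discontinuous quadratic form, so laws
    at nearby levels must be corrected to hit x exactly, at vanishing cost. Resampling from digit j
    on never raises the entropy and multiplies the form by no less than (j + 1) / (j + 2), since
    prod (1 - 1/(i + 2)^2) telescopes. That loss is repaired by a mass of order 1/j on the points
    with first j digits 0; this event has probability at least 1/(j + 1) under nu, so the mass costs
    about (ln j)/j, which tends to 0. The mass has to be scaled by 1/(1 - x), and the lowering move
    costs the square root of the relative excess over x: this is why x = 1 and x = 0 need other
    arguments. The value ln 2 at x = 0 is sharp because the first prime is 2: forcing a fair coin to
    show 1 costs ln 2 and makes the form vanish. The entropy lower bounds all come from ln y <= y -
    1, integrated against a test density which need not be normalised. *)

Lemma next_primeP m : (m < next_prime m)%N /\ prime (next_prime m).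
Proof. by rewrite /next_prime; case: ex_minnP => p /andP[]. Qed.

Lemma next_prime_min m p : (m < p)%N -> prime p -> (next_prime m <= p)%N.
Proof.
by move=> mp pp; rewrite /next_prime; case: ex_minnP => q _; apply; rewrite mp.
Qed.

Lemma prime_nth_prime i : prime (nth_prime i).
Proof. by rewrite /nth_prime iterS; case: (next_primeP (iter i next_prime 1%N)). Qed.

Lemma ltn_nth_primeS i : (nth_prime i < nth_prime i.+1)%N.
Proof. by rewrite {2}/nth_prime iterS; case: (next_primeP (nth_prime i)). Qed.

Lemma ltn_nth_prime : {homo nth_prime : i j / (i < j)%N}.
Proof. by apply: homo_ltn; [exact: ltn_trans | exact: ltn_nth_primeS]. Qed.

Lemma nth_prime_inj : injective nth_prime.
Proof.
move=> i j e; case: (ltngtP i j) => // /ltn_nth_prime; by rewrite e ltnn.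
Qed.

Lemma nth_prime_ge i : (i.+2 <= nth_prime i)%N.
Proof.
elim: i => [|i ih]; first exact: prime_gt1 (prime_nth_prime 0).
exact: leq_ltn_trans ih (ltn_nth_primeS i).
Qed.

Lemma nth_prime_surj p : prime p -> exists i, nth_prime i = p.
Proof.
move=> pp.
have [i ip imax] : exists2 i, (p <= nth_prime i)%N & forall j, (p <= nth_prime j)%N -> (i <= j)%N.
  have ex : exists i, (p <= nth_prime i)%N.
    by exists p; apply: leq_trans (nth_prime_ge p); rewrite -addn2 leq_addr.
  by case: (ex_minnP ex) => i; exists i.
exists i; apply/eqP; rewrite eqn_leq ip andbT.
case: i ip imax => [|i] ip imax.
  by apply: next_prime_min => //; exact: prime_gt1.
apply: next_prime_min => //; rewrite ltnNge; apply/negP => /imax.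
by rewrite ltnn.
Qed.

Lemma coprime_nth_prime m n : (0 < m)%N -> (0 < n)%N ->
  reflect (forall i, ~~ ((nth_prime i %| m) && (nth_prime i %| n))%N) (coprime m n).
Proof.
move=> m0 n0; apply: (iffP idP) => [cmn i|H].
  apply/negP => /andP[pm pn]; have := prime_nth_prime i.
  have : (nth_prime i %| gcdn m n)%N by rewrite dvdn_gcd pm.
  by rewrite (eqP cmn) dvdn1 => /eqP ->.
rewrite /coprime; apply/negP => /negP g1.
have g0 : (0 < gcdn m n)%N by rewrite gcdn_gt0 m0.
have pp : prime (pdiv (gcdn m n)).
  by apply: pdiv_prime; rewrite ltn_neqAle eq_sym g1.
have [i ip] := nth_prime_surj pp.
have := H i; rewrite ip -dvdn_gcd pdiv_dvd.
by [].
Qed.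

Section PrimeProducts.
Variable R : realType.
Implicit Types (i j k m n : nat).

Definition pr i : R := (nth_prime i)%:R^-1.

Lemma pr_gt0 i : 0 < pr i.
Proof. by rewrite invr_gt0 ltr0n prime_gt0 ?prime_nth_prime. Qed.

Lemma pr_le i : pr i <= i.+2%:R^-1.
Proof.
have h : i.+2%:R <= (nth_prime i)%:R :> R by rewrite ler_nat nth_prime_ge.
rewrite /pr lef_pV2 // posrE ltr0n //.
exact/prime_gt0/prime_nth_prime.
Qed.

Lemma pr_le_half i : pr i <= 2^-1.
Proof.
apply: (le_trans (pr_le i)); rewrite lef_pV2 ?posrE ?ltr0n //.
by rewrite ler_nat.
Qed.

Lemma pr0 : pr 0 = 2^-1.
Proof.
rewrite /pr; congr (_%:R^-1); apply/eqP; rewrite eqn_leq nth_prime_ge andbT.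
exact: next_prime_min.
Qed.

(** Probability that two independent points of law nu share no digit with index in [[j, k)]: at
    index i both digits are 1 with probability [pr i ^+ 2]. *)
Definition cseg j k : R := \prod_(j <= i < k) (1 - pr i ^+ 2).

Lemma cfactor_bounds i : 0 < 1 - pr i ^+ 2 <= 1.
Proof. by have := pr_gt0 i; have := pr_le_half i; nra. Qed.

Lemma cseg_gt0 j k : 0 < cseg j k.
Proof. by apply: prodr_gt0 => i _; case/andP: (cfactor_bounds i). Qed.

Lemma cseg_le1 j k : cseg j k <= 1.
Proof.
by apply: prodr_ile1 => i _; case/andP: (cfactor_bounds i) => /ltW -> ->.
Qed.

Lemma cseg_cat j k m : (j <= k)%N -> (k <= m)%N -> cseg j m = cseg j k * cseg k m.
Proof. by move=> jk km; rewrite /cseg (big_cat_nat jk km). Qed.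

(** As [pr i] is at most 1/(i + 2), each factor is at least (i + 1)(i + 3)/(i + 2)^2. These
    telescope to (j + 1)/(j + 2) times (k + 2)/(k + 1), and the induction carries the second
    quotient along. *)
Lemma cseg_ge j k : j.+1%:R / j.+2%:R <= cseg j k.
Proof.
have [kj|jk] := leqP k j.
  rewrite /cseg big_geq // ler_pdivrMr ?ltr0n // mul1r ler_nat.
  exact: leqnSn.
apply: (@le_trans _ _ (j.+1%:R / j.+2%:R * (k.+2%:R / k.+1%:R))).
  rewrite ler_peMr ?divr_ge0 //.
  by rewrite ler_pdivlMr ?ltr0n // mul1r ler_nat.
rewrite /cseg; elim: k jk => // k ih; rewrite ltnS leq_eqVlt => /predU1P[<-|jk].
  rewrite big_nat1; have := pr_le j; have := pr_gt0 j.
  set q := pr j => q0 qj.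
  have : q ^+ 2 <= (j.+2%:R^-1) ^+ 2.
    by rewrite lerXn2r // ?nnegrE ?invr_ge0 ?ler0n // ltW.
  have -> : j.+1%:R / j.+2%:R * (j.+3%:R / j.+2%:R) = 1 - j.+2%:R^-1 ^+ 2 :> R.
    rewrite -!natr1; have j0 : (0 : R) <= j%:R by []. 
    by field; lra.
  by rewrite lerD2l lerN2.
rewrite big_nat_recr /=; last exact: ltnW.
have := ih jk; set P := \prod_(_ <= i < _) _ => PP.
have {PP} : j.+1%:R / j.+2%:R * (k.+2%:R / k.+1%:R) * (1 - k.+2%:R^-1 ^+ 2) <= P * (1 - pr k ^+ 2).
  apply: ler_pM => //.
  - by rewrite subr_ge0 expr_le1 ?invr_ge0 // invf_le1 ?ltr0n // ler1n.
  - rewrite lerD2l lerN2 lerXn2r ?nnegrE ?pr_le ?invr_ge0 //; exact/ltW/pr_gt0.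
apply: le_trans; rewrite le_eqVlt; apply/orP; left; apply/eqP.
rewrite -!natr1; have j0 : (0 : R) <= j%:R by [].
have k0 : (0 : R) <= k%:R by [].
by field; lra.
Qed.

Definition cinf j : R := limn (cseg j).

Lemma cvg_cseg j : cseg j n @[n --> \oo] --> cinf j.
Proof.
apply/cvg_ex; exists (inf (range (fun n => cseg j (j + n)%N))).
rewrite -(cvg_shiftn j).
under eq_fun do rewrite addnC.
apply: nonincreasing_cvgn; last by exists 0 => _ [n _ <-]; exact/ltW/cseg_gt0.
apply/nonincreasing_seqP => n; rewrite addnS (@cseg_cat _ (j + n)%N) ?leq_addr //.
by rewrite ler_piMr ?cseg_le1 // ltW ?cseg_gt0.
Qed.

Lemma cinf_le1 j : cinf j <= 1.
Proof. by apply: limr_le; [exact: cvg_cseg | apply: nearW => n; exact: cseg_le1]. Qed.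

Lemma cinf_ge j : j.+1%:R / j.+2%:R <= cinf j.
Proof. by apply: limr_ge; [exact: cvg_cseg | apply: nearW => n; exact: cseg_ge]. Qed.

Lemma cinf_gt0 j : 0 < cinf j.
Proof. by apply: lt_le_trans (cinf_ge j); rewrite divr_gt0. Qed.

Lemma cinf_cat j k : (j <= k)%N -> cinf j = cseg j k * cinf k.
Proof.
move=> jk; apply/cvg_lim => //.
apply: (@cvg_trans _ (cseg j k * cseg k n @[n --> \oo])); last first.
  by apply: cvgMr; exact: cvg_cseg.
apply: near_eq_cvg; near=> n; rewrite (@cseg_cat j k n) //.
by near: n; exact: nbhs_infty_ge.
Unshelve. all: by end_near. Qed.

End PrimeProducts.

(** * Laws of finitely many digits *)

Section RelativeEntropy.
Variables (R : realType) (T : finType).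
Implicit Types p q r : T -> R.

Definition prob_vec p := (forall b, 0 <= p b) /\ \sum_b p b = 1.

Definition relent p q : R := \sum_b p b * ln (p b / q b).

Definition mix (s : R) p q : T -> R := fun b => (1 - s) * p b + s * q b.

Lemma ln_le_subr1 (x : R) : 0 < x -> ln x <= x - 1.
Proof.
move=> x0; rewrite -{1}(subrK 1 x) addrC; apply: le_ln1Dx; lra.
Qed.

(** Apply ln y <= y - 1 to y = q/p. The test vector [q] may have any mass, its defect being the term
    [1 - \sum_b q b]; this allows tests adapted to an event without normalising constants. *)
Lemma gibbs p q r : prob_vec p -> (forall b, 0 <= q b) -> (forall b, 0 < r b) ->
  (forall b, p b != 0 -> 0 < q b) ->
  \sum_b p b * ln (q b / r b) + 1 - \sum_b q b <= relent p r.
Proof.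
move=> [p0 <-] q0 r0 pq; rewrite /relent -big_split /= -sumrB.
apply: ler_sum => b _.
have [->|pb] := eqVneq (p b) 0; first by rewrite !mul0r !add0r oppr_le0.
have pp : 0 < p b by rewrite lt_def pb p0.
have qb := pq _ pb; have rb := r0 b.
have h := @ln_le_subr1 (q b / p b) (divr_gt0 qb pp).
rewrite !ln_div ?posrE //; rewrite ln_div ?posrE // in h.
have : p b * (ln (q b) - ln (p b)) <= p b * (q b / p b - 1) by rewrite ler_wpM2l.
rewrite [X in _ <= X -> _]mulrBr mulr1 mulrCA divff // mulr1.
lra.
Qed.

Lemma gibbs1 p q r : prob_vec p -> (forall b, 0 <= q b) -> \sum_b q b = 1 ->
  (forall b, 0 < r b) -> (forall b, p b != 0 -> 0 < q b) ->
  \sum_b p b * ln (q b / r b) <= relent p r.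
Proof. by move=> hp q0 q1 r0 pq; have := gibbs hp q0 r0 pq; rewrite q1 addrK. Qed.

Lemma relent_ge0 p q : prob_vec p -> prob_vec q -> (forall b, 0 < q b) ->
  0 <= relent p q.
Proof.
move=> hp [q0 q1] qpos; have := gibbs1 hp q0 q1 qpos (fun b _ => qpos b).
rewrite big1 // => b _; rewrite divff ?ln1 ?mulr0 // gt_eqF //.
Qed.

Lemma prob_vec_mix s p q : 0 <= s <= 1 -> prob_vec p -> prob_vec q ->
  prob_vec (mix s p q).
Proof.
move=> /andP[s0 s1] [p0 p1] [q0 q1]; split=> [b|].
  by rewrite addr_ge0 // mulr_ge0 // subr_ge0.
by rewrite big_split /= -!mulr_sumr p1 q1; ring.
Qed.

(** The entropy of the mixture is the weighted sum of the averages of its own log density under [p]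
    and under [q]; Gibbs' inequality with the mixture as test bounds both. For s = 0 or s = 1 the
    mixture may miss the support of one of them, hence the separate cases. *)
Lemma relent_convex s p q r : 0 <= s <= 1 -> prob_vec p -> prob_vec q ->
  (forall b, 0 < r b) ->
  relent (mix s p q) r <= (1 - s) * relent p r + s * relent q r.
Proof.
move=> s01 hp hq r0; have [p0 p1] := hp; have [q0 q1] := hq.
have [m0 m1] := prob_vec_mix s01 hp hq.
have [->|sn0] := eqVneq s 0.
  rewrite subr0 mul1r mul0r addr0 le_eqVlt; apply/orP; left; apply/eqP.
  by apply: eq_bigr => b _; rewrite /mix subr0 mul1r mul0r addr0.
have [->|sn1] := eqVneq s 1.
  rewrite subrr mul1r mul0r add0r le_eqVlt; apply/orP; left; apply/eqP.
  by apply: eq_bigr => b _; rewrite /mix subrr mul1r mul0r add0r.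
have [s0 s1] : 0 < s /\ 0 < 1 - s by move: s01 sn0 sn1; lra.
have -> : relent (mix s p q) r =
    (1 - s) * (\sum_b p b * ln (mix s p q b / r b)) +
    s * (\sum_b q b * ln (mix s p q b / r b)).
  rewrite !mulr_sumr -big_split; apply: eq_bigr => b _ /=.
  by rewrite {1}/mix; ring.
apply: lerD; rewrite ler_pM2l //; apply: gibbs1 => // b pb.
  rewrite ltr_pwDl ?mulr_ge0 ?(ltW s0) // mulr_gt0 // lt_def pb p0 //.
rewrite ltr_wpDl ?mulr_ge0 ?(ltW s1) // mulr_gt0 // lt_def pb q0 //.
Qed.

End RelativeEntropy.

(** * Digit laws, the disjointness form, and forcing the first digit *)

Section Codes.
Variable R : realType.
Implicit Types (i j k : nat).

Definition bitvec k := {ffun 'I_k -> bool}.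

Definition bern i (c : bool) : R := if c then pr R i else 1 - pr R i.

Lemma bern_gt0 i c : 0 < bern i c.
Proof. by have := pr_gt0 R i; have := pr_le_half R i; rewrite /bern; case: c; lra. Qed.

Lemma sum_bern i : \sum_c bern i c = 1.
Proof. by rewrite big_bool /= /bern addrC subrK. Qed.

Definition dlaw k (b : bitvec k) : R := \prod_(i < k) bern i (b i).

Lemma dlaw_gt0 k (b : bitvec k) : 0 < dlaw b.
Proof. by apply: prodr_gt0 => i _; exact: bern_gt0. Qed.

Lemma sum_bitvec k (F : 'I_k -> bool -> R) :
  \sum_(b : bitvec k) \prod_i F i (b i) = \prod_i \sum_c F i c.
Proof. by rewrite bigA_distr_bigA. Qed.

Lemma prob_vec_dlaw k : prob_vec (@dlaw k).
Proof.
split=> [b|]; first exact/ltW/dlaw_gt0.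
by rewrite (sum_bitvec (fun i : 'I_k => bern i)) big1 // => i _; rewrite sum_bern.
Qed.

Definition disj k (b b' : bitvec k) := [forall i, ~~ (b i && b' i)].

Lemma disjC k (b b' : bitvec k) : disj b b' = disj b' b.
Proof. by apply: eq_forallb => i; rewrite andbC. Qed.

(** The relation is a parameter because three are needed: disjointness of all digits, of the first
    [j] digits, and the pullback of the latter along a map. *)
Definition form (T : finType) (w : rel T) (p q : T -> R) : R :=
  \sum_b \sum_b' p b * q b' * (w b b')%:R.

Section Form.
Variables (T : finType) (w : rel T).
Implicit Types p q : T -> R.

Lemma form_ge0 p q :
  (forall b, 0 <= p b) -> (forall b, 0 <= q b) -> 0 <= form w p q.
Proof. by move=> p0 q0; do 2!apply: sumr_ge0 => ? _; rewrite !mulr_ge0. Qed.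

Lemma form_le1 p : prob_vec p -> form w p p <= 1.
Proof.
move=> [p0 p1]; rewrite -[leRHS]mulr1 -{2}p1 -p1 big_distrl /=.
apply: ler_sum => b _; rewrite mulr_sumr; apply: ler_sum => b' _.
by rewrite ler_piMr ?mulr_ge0 //; case: w.
Qed.

Lemma form_mix s p q : symmetric w ->
  form w (mix s p q) (mix s p q) =
  (1 - s) ^+ 2 * form w p p + s * (1 - s) * 2 * form w p q + s ^+ 2 * form w q q.
Proof.
move=> wC; have fC : form w q p = form w p q.
  rewrite /form exchange_big; apply: eq_bigr => b _; apply: eq_bigr => b' _.
  by rewrite wC [p _ * _]mulrC.
have -> : s * (1 - s) * 2 * form w p q = s * (1 - s) * form w p q + s * (1 - s) * form w q p.
  by rewrite fC; ring.
rewrite /form !mulr_sumr -!big_split /=; apply: eq_bigr => b _.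
rewrite !mulr_sumr -!big_split /=; apply: eq_bigr => b' _.
by rewrite /mix; ring.
Qed.

End Form.

Definition dform k (p q : bitvec k -> R) : R := form (@disj k) p q.

(* Setting the digit of the prime 2 kills all disjointness between modified
   points, and costs at most ln 2 because that digit is a fair coin under the
   digit law. *)
Definition set_bit k (c : bool) (b : bitvec k.+1) : bitvec k.+1 :=
  [ffun i => if i == ord0 then c else b i].

Definition push1 k (p : bitvec k.+1 -> R) : bitvec k.+1 -> R :=
  fun b => if b ord0 then p b + p (set_bit false b) else 0.

Lemma set_bitE k c (b : bitvec k.+1) (i : 'I_k.+1) :
  set_bit c b i = if i == ord0 then c else b i.
Proof. by rewrite ffunE. Qed.

Lemma set_bit0 k c (b : bitvec k.+1) : set_bit c b ord0 = c.
Proof. by rewrite ffunE eqxx. Qed.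

Lemma set_bitK k c c' (b : bitvec k.+1) : set_bit c (set_bit c' b) = set_bit c b.
Proof. by apply/ffunP => i; rewrite !ffunE; case: eqP. Qed.

Lemma set_bit_id k (b : bitvec k.+1) : set_bit (b ord0) b = b.
Proof. by apply/ffunP => i; rewrite !ffunE; case: eqP => [->|]. Qed.

(** This identifies [push1 p] as the image of [p] under [set_bit true]; the proof matches each point
    with first digit 0 to its flip. *)
Lemma sum_push1 k (p F : bitvec k.+1 -> R) :
  \sum_b push1 p b * F b = \sum_b p b * F (set_bit true b).
Proof.
rewrite (bigID (fun b : bitvec k.+1 => b ord0)) /= [X in _ + X]big1 ?addr0; last first.
  by move=> b /negbTE b0; rewrite /push1 b0 mul0r.
rewrite [RHS](bigID (fun b : bitvec k.+1 => b ord0)) /=.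
rewrite [X in _ = _ + X](reindex_onto (set_bit false) (set_bit true)) /=; last first.
  by move=> b /negbTE b0; rewrite set_bitK -{2}(set_bit_id b) b0.
rewrite [X in _ = _ + X](eq_bigl (fun b : bitvec k.+1 => b ord0)); last first.
  move=> b /=; rewrite set_bit0 /= set_bitK; apply/eqP/idP => [<-|b0].
    by rewrite set_bit0.
  by rewrite -{2}(set_bit_id b) b0.
rewrite -big_split /=; apply: eq_bigr => b b0; rewrite /push1 b0 set_bitK.
by rewrite -mulrDl; congr (_ * F _); rewrite -{1}(set_bit_id b) b0.
Qed.

Lemma prob_vec_push1 k (p : bitvec k.+1 -> R) : prob_vec p -> prob_vec (push1 p).
Proof.
move=> [p0 p1]; split=> [b|]; first by rewrite /push1; case: ifP => // _; rewrite addr_ge0.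
have := sum_push1 p (fun=> 1); under eq_bigr do rewrite mulr1.
by under [X in _ = X -> _]eq_bigr do rewrite mulr1; rewrite p1.
Qed.

Lemma dlaw_set_bit k c (b : bitvec k.+1) : dlaw (set_bit c b) = dlaw b.
Proof.
rewrite /dlaw !big_ord_recl; congr (_ * _); last first.
  by apply: eq_bigr => i _; rewrite set_bitE.
by rewrite set_bit0 /bern pr0; case: c; case: (b _); lra.
Qed.

(** Flipping the first digit preserves the digit law, so the density of [push1 p] on first digit 1
    is twice that of the flip-symmetrised law [q]. The factor 2 gives ln 2, and Gibbs' inequality
    with test [q] does the rest. *)
Lemma relent_push1 k (p : bitvec k.+1 -> R) : prob_vec p ->
  relent (push1 p) (@dlaw _) <= ln 2 + relent p (@dlaw _).
Proof.
move=> hp; have [p0 p1] := hp.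
pose flip (b : bitvec k.+1) := set_bit (~~ b ord0) b.
have flipK : involutive flip.
  by move=> b; rewrite /flip set_bitK set_bit0 negbK set_bit_id.
pose q (b : bitvec k.+1) := (p b + p (flip b)) / 2.
have q1 : \sum_b q b = 1.
  have e : \sum_b p (flip b) = 1 by rewrite -p1 [RHS](reindex_inj (inv_inj flipK)).
  by rewrite /q -mulr_suml big_split /= e p1; lra.
have pq b : p b != 0 -> 0 < q b.
  move=> pb; rewrite /q divr_gt0 // ltr_pwDl // lt_def pb p0 //.
have q0 b : 0 <= q b by rewrite /q divr_ge0 // addr_ge0.
apply: (@le_trans _ _ (ln 2 + \sum_b p b * ln (q b / dlaw b))); last first.
  by rewrite lerD2l; apply: gibbs1 => // b; exact: dlaw_gt0.
rewrite /relent sum_push1 -[ln 2]mul1r -{1}p1 mulr_suml -big_split /=.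
apply: ler_sum => b _; have [->|pb] := eqVneq (p b) 0; first by rewrite !mul0r addr0.
have qb : 0 < q b / dlaw b by rewrite divr_gt0 ?dlaw_gt0 // pq.
rewrite -mulrDr ler_wpM2l // -lnM ?posrE //.
rewrite /push1 set_bit0 set_bitK dlaw_set_bit.
have -> : p (set_bit true b) + p (set_bit false b) = 2 * q b.
  rewrite /q mulrC divfK ?pnatr_eq0 // /flip -{3}(set_bit_id b).
  by case: (b ord0) => //; rewrite addrC.
by rewrite mulrA.
Qed.

Lemma dform_push1 k (p : bitvec k.+1 -> R) : (forall b, 0 <= p b) ->
  dform p (push1 p) <= dform p p.
Proof.
move=> p0; apply: ler_sum => b _.
have -> : \sum_b' p b * push1 p b' * (disj b b')%:R =
    \sum_b' p b' * (p b * (disj b (set_bit true b'))%:R).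
  rewrite -(sum_push1 p (fun b' => p b * (disj b b')%:R)).
  by apply: eq_bigr => b' _; ring.
apply: ler_sum => b' _.
have -> : p b' * (p b * (disj b (set_bit true b'))%:R) =
  p b * p b' * (disj b (set_bit true b'))%:R by ring.
rewrite ler_wpM2l ?mulr_ge0 // ler_nat.
suff : disj b (set_bit true b') -> disj b b' by case: disj => // ->.
move=> /forallP h; apply/forallP => i; move: (h i); rewrite set_bitE.
by case: eqP => // ->; rewrite andbT; case: (b ord0).
Qed.

Lemma dform_push1_push1 k (p : bitvec k.+1 -> R) : dform (push1 p) (push1 p) = 0.
Proof.
rewrite /dform /form big1 // => b _; rewrite big1 // => b' _; rewrite /push1.
case: ifP => b0; last by rewrite !mul0r.
case: ifP => b0'; last by rewrite mulr0 mul0r.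
rewrite (_ : disj b b' = false) ?mulr0 //.
by apply/negbTE/forallPn; exists ord0; rewrite b0 b0'.
Qed.

(** The cross term is at most [dform p p] and the last term vanishes, so the coefficient is (1 -
    s)^2 + 2s(1 - s) = 1 - s^2. *)
Lemma dform_mix_push1 k s (p : bitvec k.+1 -> R) : 0 <= s <= 1 ->
  (forall b, 0 <= p b) ->
  dform (mix s p (push1 p)) (mix s p (push1 p)) <= (1 - s ^+ 2) * dform p p.
Proof.
move=> s01 p0; rewrite /dform form_mix; last exact: disjC.
rewrite -/(dform _ _) -/(dform _ _) -/(dform _ _) dform_push1_push1 mulr0 addr0.
have h : s * (1 - s) * 2 * dform p (push1 p) <= s * (1 - s) * 2 * dform p p.
  by rewrite ler_wpM2l ?dform_push1 //; case/andP: s01 => *; rewrite !mulr_ge0 ?subr_ge0.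
by apply: (le_trans (lerD (lexx _) h)); rewrite -mulrDl; apply: ler_wpM2r; [exact: form_ge0 | lra].
Qed.

End Codes.

(** * Resampling digits *)

Section Resampling.
Variable R : realType.
Implicit Types (i j k : nat).
Local Notation bern := (bern R).
Local Notation pr := (pr R).
Local Notation dlaw := (@dlaw R).

Lemma sum_bitvec2 k (F : 'I_k -> bool -> bool -> R) :
  \sum_(b : bitvec k) \sum_(b' : bitvec k) \prod_i F i (b i) (b' i) =
  \prod_i \sum_c \sum_c' F i c c'.
Proof.
rewrite -(sum_bitvec (fun (i : 'I_k) c => \sum_c' F i c c')).
by apply: eq_bigr => b _; rewrite -(sum_bitvec (fun (i : 'I_k) c' => F i (b i) c')).
Qed.

Lemma prod_nat_of_forall (T : finType) (P : pred T) :
  \prod_i (P i)%:R = [forall i, P i]%:R :> R.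
Proof.
case: forallP => [h|/forallP h]; first by rewrite big1 // => i _; rewrite h.
by have /forallPn[i /negbTE Pi] := h; rewrite (bigD1 i) //= Pi mul0r.
Qed.

Lemma prod_tail j k (F : nat -> R) : (j <= k)%N ->
  \prod_(i < k) (if (i < j)%N then 1 else F i) = \prod_(j <= i < k) F i.
Proof.
move=> jk; rewrite -(big_mkord xpredT (fun i => if (i < j)%N then 1 else F i)).
rewrite (big_cat_nat (leq0n j) jk) /= big_nat_cond big1 ?mul1r; last first.
  by move=> i /andP[/andP[_ ->]].
rewrite big_nat_cond [RHS]big_nat_cond; apply: eq_bigr => i /andP[/andP[ji _] _].
by rewrite ltnNge ji.
Qed.

Definition disj_lt j k (b b' : bitvec k) :=
  [forall i : 'I_k, (i < j)%N ==> ~~ (b i && b' i)].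

Lemma disj_ltC j k : symmetric (@disj_lt j k).
Proof. by move=> b b'; apply: eq_forallb => i; rewrite andbC. Qed.

Lemma disj_ltW j k (b b' : bitvec k) : disj b b' -> disj_lt j b b'.
Proof. by move=> /forallP h; apply/forallP => i; rewrite h implybT. Qed.

Lemma disjE k (b b' : bitvec k) : (disj b b')%:R = \prod_i (~~ (b i && b' i))%:R :> R.
Proof. by rewrite prod_nat_of_forall. Qed.

(** Markov kernel that keeps the digits of [a] below [j] and redraws the others independently from
    the digit law. *)
Definition kern j k (a b : bitvec k) : R :=
  \prod_(i < k) (if (i < j)%N then (b i == a i)%:R else bern i (b i)).

Definition resample j k (p : bitvec k -> R) : bitvec k -> R :=
  fun b => \sum_a p a * kern j a b.

Definition zero_bits k : bitvec k := [ffun=> false].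

Definition dirac0 k : bitvec k -> R := fun b => (b == zero_bits k)%:R.

Lemma prob_vec_dirac0 k : prob_vec (@dirac0 k).
Proof.
split=> [b|]; first by rewrite ler0n.
rewrite (bigD1 (zero_bits k)) //= /dirac0 eqxx big1 ?addr0 // => b /negbTE ->.
by [].
Qed.

Lemma kern_ge0 j k (a b : bitvec k) : 0 <= kern j a b.
Proof. by apply: prodr_ge0 => i _; case: ifP => // _; exact/ltW/bern_gt0. Qed.

Lemma sum_kern j k (a : bitvec k) : \sum_b kern j a b = 1.
Proof.
rewrite (sum_bitvec (fun (i : 'I_k) c => if (i < j)%N then (c == a i)%:R else bern i c)).
rewrite big1 // => i _; case: (i < j)%N; last exact: sum_bern.
by rewrite big_bool; case: (a i); rewrite /= ?addr0 ?add0r.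
Qed.

Lemma prob_vec_resample j k (p : bitvec k -> R) : prob_vec p -> prob_vec (resample j p).
Proof.
move=> [p0 p1]; split=> [b|]; first by apply: sumr_ge0 => a _; rewrite mulr_ge0 ?kern_ge0.
rewrite exchange_big /= -p1; apply: eq_bigr => a _.
by rewrite -mulr_sumr sum_kern mulr1.
Qed.

Lemma sum_kern_kern_disj j k (a a' : bitvec k) : (j <= k)%N ->
  \sum_b \sum_b' kern j a b * kern j a' b' * (disj b b')%:R =
  (disj_lt j a a')%:R * cseg R j k.
Proof.
move=> jk.
under eq_bigr do under eq_bigr do rewrite disjE -!big_split /=.
rewrite (sum_bitvec2 (fun (i : 'I_k) c c' =>
   (if (i < j)%N then (c == a i)%:R else bern i c) *
   (if (i < j)%N then (c' == a' i)%:R else bern i c') * (~~ (c && c'))%:R)).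
rewrite /cseg -prod_tail // -prod_nat_of_forall -big_split /=.
apply: eq_bigr => i _; rewrite !big_bool /=; case: ifP => _ /=.
  by case: (a i); case: (a' i); rewrite /=; ring.
by rewrite /Defs.digit /bern; ring.
Qed.

(** The map [h] lets one computation serve twice: with the identity for resampling, and with
    zero-padding for the extension of a law to more digits. *)
Lemma dform_kern (A : finType) j k (h : A -> bitvec k) (p q : A -> R) : (j <= k)%N ->
  dform (fun b => \sum_a p a * kern j (h a) b) (fun b => \sum_a q a * kern j (h a) b) =
  form (fun a a' => disj_lt j (h a) (h a')) p q * cseg R j k.
Proof.
move=> jk; rewrite /dform /form mulr_suml.
transitivity (\sum_a \sum_a' p a * q a' *
    \sum_b \sum_b' kern j (h a) b * kern j (h a') b' * (disj b b')%:R); last first.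
  apply: eq_bigr => a _; rewrite mulr_suml; apply: eq_bigr => a' _.
  by rewrite sum_kern_kern_disj // mulrA.
under [RHS]eq_bigr do under eq_bigr do rewrite mulr_sumr.
under [RHS]eq_bigr do rewrite exchange_big /=.
rewrite [RHS]exchange_big /=; apply: eq_bigr => b _.
under [RHS]eq_bigr do under eq_bigr do rewrite mulr_sumr.
under [RHS]eq_bigr do rewrite exchange_big /=.
rewrite [RHS]exchange_big /=; apply: eq_bigr => b' _.
rewrite big_distrl /= big_distrl /=; apply: eq_bigr => a _.
by rewrite big_distrr /= big_distrl /=; apply: eq_bigr => a' _; ring.
Qed.

Lemma form_resample j k (p q : bitvec k -> R) : (j <= k)%N ->
  dform (resample j p) (resample j q) = form (@disj_lt j k) p q * cseg R j k.
Proof. exact: (dform_kern id). Qed.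

Lemma form_disj_lt_ge j k (p : bitvec k -> R) : (forall b, 0 <= p b) ->
  dform p p <= form (@disj_lt j k) p p.
Proof.
move=> p0; apply: ler_sum => b _; apply: ler_sum => b' _.
rewrite ler_wpM2l ?mulr_ge0 // ler_nat.
by move: (@disj_ltW j k b b'); case: disj => // h; rewrite h.
Qed.

(** A nonzero [kern j a b] means that [a] and [b] agree on the first [j] digits, and the density of
    a kernel row against the digit law depends on these digits only. *)
Lemma kern_dlaw j k (a b : bitvec k) : kern j a b != 0 ->
  forall c, kern j c a / dlaw a = kern j c b / dlaw b.
Proof.
move=> ab c; have agr (i : 'I_k) : (i < j)%N -> b i = a i.
  move=> ij; move: ab; rewrite /kern (bigD1 i) //= ij.
  by case: (b i =P a i) => //= _; rewrite mul0r eqxx.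
rewrite /kern /dlaw -!prodf_div; apply: eq_bigr => i _.
case: ifP => ij; first by rewrite agr.
by rewrite !divff // gt_eqF ?bern_gt0.
Qed.

Lemma kern_diag_gt0 j k (a : bitvec k) : 0 < kern j a a.
Proof. by apply: prodr_gt0 => i _; rewrite eqxx; case: ifP => // _; exact: bern_gt0. Qed.

Lemma resample_gt0 j k (p : bitvec k -> R) b : (forall b, 0 <= p b) ->
  p b != 0 -> 0 < resample j p b.
Proof.
move=> p0 pb; rewrite /resample (bigD1 b) //= ltr_wpDr //.
  by apply: sumr_ge0 => a _; rewrite mulr_ge0 ?kern_ge0.
by rewrite mulr_gt0 ?kern_diag_gt0 // lt_def pb p0.
Qed.

(** The density of the resampled law is constant along the kernel, by [inv]. Its entropy is
    therefore the [p]-average of its log density, which Gibbs' inequality bounds by the entropy of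
    [p]. *)
Lemma relent_resample j k (p : bitvec k -> R) : prob_vec p ->
  relent (resample j p) (@dlaw k) <= relent p (@dlaw k).
Proof.
move=> hp; have [p0 p1] := hp; have [r0 r1] := prob_vec_resample j hp.
have inv a b : kern j a b != 0 -> resample j p a / dlaw a = resample j p b / dlaw b.
  move=> ab; rewrite /resample !mulr_suml; apply: eq_bigr => c _.
  by rewrite -!mulrA (kern_dlaw ab).
suff -> : relent (resample j p) (@dlaw k) =
    \sum_a p a * ln (resample j p a / dlaw a).
  by apply: gibbs1 => // b *; [exact: dlaw_gt0 | exact: resample_gt0].
rewrite /relent; under eq_bigr do rewrite {1}/resample mulr_suml.
rewrite exchange_big /=; apply: eq_bigr => a _.
rewrite -[RHS]mulr1 -(sum_kern j a) mulr_sumr; apply: eq_bigr => b _.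
have [->|ab] := eqVneq (kern j a b) 0; first by rewrite !mulr0 mul0r.
by rewrite -(inv a b ab); ring.
Qed.

Lemma resample_mix j k s (p q : bitvec k -> R) :
  mix s (resample j p) (resample j q) = resample j (mix s p q).
Proof.
apply/funext => b; rewrite /mix /resample !mulr_sumr -big_split /=.
by apply: eq_bigr => a _; ring.
Qed.

Lemma resample_dirac0 j k : resample j (@dirac0 k) = kern j (zero_bits k).
Proof.
apply/funext => b; rewrite /resample (bigD1 (zero_bits k)) //= /dirac0 eqxx mul1r.
by rewrite big1 ?addr0 // => a /negbTE ->; rewrite mul0r.
Qed.

(** The zero vector is disjoint from everything, so only pairs drawn twice from [p] can clash; their
    weight is (1 - s)^2. *)
Lemma form_lt_dirac0 j k s (p : bitvec k -> R) : prob_vec p ->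
  form (@disj_lt j k) (mix s p (@dirac0 k)) (mix s p (@dirac0 k)) =
  1 - (1 - s) ^+ 2 * (1 - form (@disj_lt j k) p p).
Proof.
move=> [p0 p1]; rewrite form_mix; last exact: disj_ltC.
have e (q : bitvec k -> R) : \sum_b q b = 1 -> form (@disj_lt j k) q (@dirac0 k) = 1.
  move=> q1; rewrite -q1 /form; apply: eq_bigr => b _.
  rewrite (bigD1 (zero_bits k)) //= /dirac0 eqxx big1 ?addr0; last first.
    by move=> a /negbTE ->; rewrite mulr0 mul0r.
  suff -> : disj_lt j b (zero_bits k) by rewrite !mulr1.
  by apply/forallP => i; rewrite ffunE andbF implybT.
have [_ d1] := prob_vec_dirac0 k.
by rewrite (e p p1) (e _ d1); ring.
Qed.

(** Telescoping of 1 - 1/(i + 2). The product is the probability that the first [j] digits vanish,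
    so conditioning on this event costs at most ln (j + 1). *)
Lemma prod_1Bpr_ge j : j.+1%:R^-1 <= \prod_(i < j) (1 - pr i).
Proof.
elim: j => [|j ih]; first by rewrite big_ord0 invr1.
rewrite big_ord_recr /=; apply: (@le_trans _ _ (j.+1%:R^-1 * (1 - j.+2%:R^-1))).
  rewrite le_eqVlt; apply/orP; left; apply/eqP.
  by rewrite -!natr1; have j0 : (0 : R) <= j%:R by []; field; lra.
apply: ler_pM => //; last by rewrite lerD2l lerN2 pr_le.
by rewrite subr_ge0 invf_le1 ?ltr0n // ler1n.
Qed.

Lemma kern_zero_bits j k (b : bitvec k) : (j <= k)%N ->
  kern j (zero_bits k) b <= j.+1%:R * dlaw b.
Proof.
move=> jk; rewrite -ler_pdivrMr ?dlaw_gt0 // /kern /dlaw -prodf_div.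
apply: (@le_trans _ _ (\prod_(i < j) (1 - pr i)^-1)); last first.
  rewrite prodfV invf_ple ?posrE ?prod_1Bpr_ge ?ltr0n //.
  by apply: prodr_gt0 => i _; have := pr_le_half R i; lra.
rewrite (big_ord_widen k (fun i => (1 - pr i)^-1) jk) [leRHS]big_mkcond /=.
apply: ler_prod => i _; rewrite ffunE; case: ifP => ij; last first.
  by rewrite divff ?gt_eqF ?bern_gt0 // ler01 lexx.
have := pr_gt0 R i; have := pr_le_half R i; rewrite /bern.
case: (b i) => /= h1 h2; rewrite ?mul0r ?mul1r ?lexx ?invr_ge0 ?andbT //; lra.
Qed.

Lemma relent_resample_dirac0 j k : (j <= k)%N ->
  relent (resample j (@dirac0 k)) (@dlaw k) <= ln j.+1%:R.
Proof.
move=> jk; rewrite resample_dirac0.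
have -> : ln j.+1%:R = \sum_b kern j (zero_bits k) b * ln (j.+1%:R : R).
  by rewrite -mulr_suml sum_kern mul1r.
apply: ler_sum => b _.
have [->|kb] := eqVneq (kern j (zero_bits k) b) 0; first by rewrite !mul0r.
rewrite ler_wpM2l ?kern_ge0 // ler_ln ?posrE ?ltr0n //.
  by rewrite ler_pdivrMr ?dlaw_gt0 // kern_zero_bits.
by rewrite divr_gt0 ?dlaw_gt0 // lt_def kb kern_ge0.
Qed.

End Resampling.

(** * Divergence of prod (1 - 1/p) to 0, after Euler *)

Section MertensDivergence.
Variable R : realType.
Implicit Types (i j n : nat).

(** For positive [a]: every prime factor is among the first [j] primes. Bounding the index by [a]
    keeps the predicate boolean and suffices since [nth_prime i] exceeds [i]. *)
Definition smooth j a := [forall i : 'I_a.+1, (nth_prime i %| a)%N ==> (i < j)%N].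

Lemma smoothP j a : (0 < a)%N ->
  reflect (forall i, (nth_prime i %| a)%N -> (i < j)%N) (smooth j a).
Proof.
move=> a0; apply: (iffP forallP) => [h i ia|h i]; last by apply/implyP/h.
have ia1 : (i < a.+1)%N.
  have := dvdn_leq a0 ia; have := nth_prime_ge i; lia.
exact: (implyP (h (Ordinal ia1))).
Qed.

Definition smooth_sum j n : R :=
  \sum_(a < n.+1 | (0 < a)%N && smooth j a) a%:R^-1.

(** Split by divisibility by the prime of index [j]: the non-multiples are already [j]-smooth, and a
    multiple is that prime times a smaller integer which is again [j.+1]-smooth. Solving for the
    left sum yields one Euler factor without any geometric series. *)
Lemma smooth_sum_rec j n :
  smooth_sum j.+1 n <= smooth_sum j n + pr R j * smooth_sum j.+1 n.
Proof.
have p0 : (0 < nth_prime j)%N by rewrite prime_gt0 ?prime_nth_prime.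
rewrite [leLHS](bigID (fun a : 'I_n.+1 => (nth_prime j %| a)%N)) /= addrC; apply: lerD.
  rewrite big_mkcond [leRHS]big_mkcond /=; apply: ler_sum => a _.
  case: ifP => [/andP[/andP[a0 /(smoothP _ a0) sa] ja]|_]; last by case: ifP.
  rewrite a0 ifT //=; apply/smoothP => // i ia; have := sa i ia.
  by rewrite ltnS leq_eqVlt => /predU1P[ij|//]; rewrite -ij ia in ja.
apply: (@le_trans _ _ (\sum_(a < n.+1 | [&& (0 < a)%N, smooth j.+1 a & (nth_prime j %| a)%N])
    \sum_(b < n.+1 | a == nth_prime j * b :> nat) pr R j * b%:R^-1)).
  rewrite le_eqVlt; apply/orP; left; apply/eqP.
  rewrite (eq_bigl (fun a : 'I_n.+1 => [&& (0 < a)%N, smooth j.+1 a & (nth_prime j %| a)%N])); last first.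
    by move=> a; rewrite -andbA.
  apply: eq_bigr => a /and3P[a0 _ ja].
  have bn : (a %/ nth_prime j < n.+1)%N by apply: leq_ltn_trans (leq_div _ _) (ltn_ord a).
  rewrite (big_pred1 (Ordinal bn)) /= => [|b].
    by rewrite /pr -invfM -natrM mulnC divnK.
  apply/eqP/eqP => [e|e]; last first.
    by rewrite e [RHS]mulnC; apply/esym/divnK.
  by apply: val_inj => /=; rewrite e mulKn.
rewrite (exchange_big_dep (fun b : 'I_n.+1 => (0 < b)%N && smooth j.+1 b)) /=; last first.
  move=> a b /and3P[a0 /(smoothP _ a0) sa _] /eqP e.
  have b0 : (0 < b)%N by move: a0; rewrite e muln_gt0 p0.
  by rewrite b0; apply/smoothP => // i ib; apply: sa; rewrite e dvdn_mull.
rewrite mulr_sumr; apply: ler_sum => b _; rewrite sumr_const.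
rewrite -[leRHS]mulr1n ler_wpMn2l //; first by rewrite mulr_ge0 // ltW ?pr_gt0.
apply/card_le1_eqP => a a' /andP[_ /eqP e] /andP[_ /eqP e'].
by apply: val_inj; rewrite /= e e'.
Qed.

Lemma smooth_sum_le j n : smooth_sum j n <= \prod_(i < j) (1 - pr R i)^-1.
Proof.
elim: j => [|j ih].
  rewrite big_ord0 /smooth_sum.
  have [n0|n0] := posnP n.
    by subst n; rewrite big_pred0 ?ler01 // => a; rewrite ord1.
  rewrite (big_pred1 (Ordinal (_ : 1 < n.+1)%N)) ?invr1 // => a /=.
  apply/andP/eqP => [[a0 /(smoothP _ a0) sa]|->]; last first.
    split => //; apply/smoothP => // i; rewrite dvdn1 => /eqP e.
    by have := nth_prime_ge i; rewrite e.
  apply: val_inj => /=; apply/eqP; rewrite eqn_leq a0 andbT leqNgt; apply/negP => a1.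
  by have [i ip] := nth_prime_surj (pdiv_prime a1); have := sa i; rewrite ip pdiv_dvd => /(_ isT).
rewrite big_ord_recr /= ler_pdivlMr; last by have := pr_le_half R j; lra.
by apply: le_trans ih; have := smooth_sum_rec j n; lra.
Qed.

Lemma smooth_sum_harmonic n : smooth_sum n n = series harmonic n.
Proof.
rewrite /series /= /smooth_sum big_mkcond big_ord_recl /= add0r big_mkord.
apply: eq_bigr => i _; rewrite /bump /= add1n ifT //; apply/smoothP => // k ki.
have := dvdn_leq (ltn0Sn i) ki; have := nth_prime_ge k; have := ltn_ord i; lia.
Qed.

(** Every positive a <= n is [n]-smooth, so a positive lower bound on the products would bound the
    harmonic series. *)
Lemma prod_1Bpr_small (e : R) : 0 < e -> exists j, \prod_(i < j) (1 - pr R i) < e.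
Proof.
move=> e0; apply: contrapT => /forallNP H.
have bnd n : series harmonic n <= e^-1.
  rewrite -smooth_sum_harmonic; apply: le_trans (smooth_sum_le _ _) _.
  rewrite prodfV lef_pV2 ?posrE //; first by rewrite leNgt; apply/negP/H.
  by apply: prodr_gt0 => i _; have := pr_le_half R i; lra.
apply: (@dvg_harmonic R); apply: nondecreasing_is_cvgn.
  by apply/nondecreasing_seqP => n; rewrite seriesSr lerDl harmonic_ge0.
by exists e^-1 => _ [n _ <-].
Qed.

End MertensDivergence.

Section QuadraticIVT.
Variable R : realType.

(** The form of a mixture is quadratic in the mixing weight; this is how prescribed values are hit
    exactly. *)
Lemma quadratic_ivt (a b c s v : R) : 0 <= s ->
  (a <= v <= a + b * s + c * s ^+ 2) || (a + b * s + c * s ^+ 2 <= v <= a) ->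
  exists2 r, 0 <= r <= s & a + b * r + c * r ^+ 2 = v.
Proof.
move=> s0 hv; pose f r := a + b * r + c * r ^+ 2.
have cf : continuous f.
  move=> r; apply: cvgD; last by apply: cvgMr; exact: exprn_continuous.
  by apply: cvgD; [exact: cvg_cst | apply: cvgMr; exact: cvg_id].
have [] := @IVT R f 0 s v s0.
- exact: continuous_subspaceT.
- rewrite /f mulr0 expr0n /= mulr0 !addr0 ge_min le_max.
  by case/orP: hv => /andP[-> ->]; rewrite ?orbT.
- by move=> r; rewrite in_itv /= => rs fr; exists r.
Qed.

End QuadraticIVT.

(** * From approximate to exact values of the form *)

Section Approximation.
Variable R : realType.
Implicit Types (i j k : nat).
Local Notation bern := (bern R).
Local Notation pr := (pr R).
Local Notation dlaw := (@dlaw R).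
Local Notation cinf := (cinf R).

Lemma relent_mix_le k s (p q : bitvec k -> R) c : 0 <= s <= 1 ->
  prob_vec p -> prob_vec q -> 0 <= c ->
  relent q (@dlaw k) <= relent p (@dlaw k) + c ->
  relent (mix s p q) (@dlaw k) <= relent p (@dlaw k) + s * c.
Proof.
move=> s01 hp hq c0 hc; apply: (le_trans (relent_convex s01 hp hq (@dlaw_gt0 R k))).
by move: s01 => /andP[s0 s1]; nra.
Qed.

Lemma mix_ivt k s (p q : bitvec k -> R) y : 0 <= s ->
  (dform p p <= y <= dform (mix s p q) (mix s p q)) ||
  (dform (mix s p q) (mix s p q) <= y <= dform p p) ->
  exists2 r, 0 <= r <= s & dform (mix r p q) (mix r p q) = y.
Proof.
move=> s0 hy.
have e r : dform (mix r p q) (mix r p q) = dform p p + (2 * (dform p q - dform p p)) * r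
    + (dform p p - 2 * dform p q + dform q q) * r ^+ 2.
  rewrite /dform form_mix; last exact: disjC.
  by ring.
rewrite e in hy; have [r rs hr] := quadratic_ivt s0 hy.
by exists r => //; rewrite e.
Qed.

(** The weight [s] solves [(1 - s ^+ 2) * (c * F) = x], so mixing in [push1 p] with weight [s]
    brings the form to x or below; some weight r <= s then gives x. *)
Lemma lower_dform k (p : bitvec k.+1 -> R) x : prob_vec p ->
  0 <= x -> 0 < dform p p -> x <= cinf k.+1 * dform p p ->
  exists q : bitvec k.+1 -> R, [/\ prob_vec q,
    relent q (@dlaw _) <= relent p (@dlaw _) +
       Num.sqrt (1 - x / (cinf k.+1 * dform p p)) * ln 2 &
    cinf k.+1 * dform q q = x].
Proof.
move=> hp x0 F0 xF; have [p0 p1] := hp.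
have c0 := cinf_gt0 R k.+1; set c := cinf k.+1 in xF c0 *.
set F := dform p p in F0 xF *; pose s := Num.sqrt (1 - x / (c * F)).
have cF0 : 0 < c * F by rewrite mulr_gt0.
have xcF : 0 <= x / (c * F) <= 1 by rewrite divr_ge0 ?ler_pdivrMr ?mul1r //= ltW.
have s2 : s ^+ 2 = 1 - x / (c * F) by rewrite sqr_sqrtr //; lra.
have s0 : 0 <= s by exact: sqrtr_ge0.
have s1 : s <= 1 by nra.
have s01 : 0 <= s <= 1 by rewrite s0 s1.
have [r /andP[r0 rs] hr] : exists2 r, 0 <= r <= s &
    dform (mix r p (push1 p)) (mix r p (push1 p)) = x / c.
  apply: mix_ivt => //; apply/orP; right; apply/andP; split.
    apply: (le_trans (dform_mix_push1 s01 p0)); rewrite s2 -/F.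
    by rewrite opprB addrC subrK invfM -mulrA mulfVK ?gt_eqF // mulrC.
  by rewrite ler_pdivrMr // mulrC.
have r1 : r <= 1 by apply: le_trans s1.
exists (mix r p (push1 p)); split.
- by apply: prob_vec_mix; rewrite ?r0 ?r1 //; exact: prob_vec_push1.
- have ln2 : 0 <= ln 2 :> R by apply: ln_ge0; rewrite ler1n.
  apply: (@le_trans _ _ (relent p (@dlaw _) + r * ln 2)); last by rewrite lerD2l ler_wpM2r.
  apply: relent_mix_le; rewrite ?r0 ?r1 //; first exact: prob_vec_push1.
  by rewrite addrC; exact: relent_push1.
- by rewrite hr mulrC divfK // gt_eqF.
Qed.

(** Resampling from [j] on replaces the factor [cinf k] by [cinf j] and the form by the larger one
    that tests [j] digits only; the mass [s] at zero compensates for this factor. The target [q]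
    overshoots x, and the path from [p] to [q] crosses it. *)
Lemma raise_dform j k s (p : bitvec k -> R) x : (j <= k)%N -> prob_vec p ->
  0 <= s <= 1 -> cinf k * dform p p <= x ->
  x <= cinf j * (1 - (1 - s) ^+ 2 * (1 - dform p p)) ->
  exists q : bitvec k -> R, [/\ prob_vec q,
    relent q (@dlaw _) <= relent p (@dlaw _) + s * ln j.+1%:R &
    cinf k * dform q q = x].
Proof.
move=> jk hp s01 px xs; have [p0 p1] := hp.
pose q := resample j (mix s p (@dirac0 R k)).
have hd := prob_vec_dirac0 R k.
have hq : prob_vec q by apply: prob_vec_resample; exact: prob_vec_mix.
have c0 := cinf_gt0 R k.
have qx : x <= cinf k * dform q q.
  rewrite form_resample // form_lt_dirac0 // [X in _ <= _ * X]mulrC mulrA [cinf k * _]mulrC -cinf_cat //.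
  apply: (le_trans xs); rewrite ler_pM2l ?cinf_gt0 // lerD2l lerN2.
  rewrite ler_wpM2l ?sqr_ge0 // lerD2l lerN2; exact: form_disj_lt_ge.
have lnj : 0 <= ln j.+1%:R :> R by apply: ln_ge0; rewrite ler1n.
have sl : 0 <= s * ln j.+1%:R :> R by rewrite mulr_ge0 //; case/andP: s01.
have Hq : relent q (@dlaw _) <= relent p (@dlaw _) + s * ln j.+1%:R.
  rewrite /q -resample_mix.
  apply: (le_trans (relent_convex s01 (prob_vec_resample j hp) (prob_vec_resample j hd) (@dlaw_gt0 R k))).
  have h1 := relent_resample j hp; have h2 := @relent_resample_dirac0 R j k jk.
  have h3 := relent_ge0 hp (prob_vec_dlaw R k) (@dlaw_gt0 R k).
  by move: s01 => /andP[s0 s1]; nra.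
have m1 : mix 1 p q = q by apply/funext => b; rewrite /mix subrr mul0r add0r mul1r.
have [r r01 hr] : exists2 r, 0 <= r <= 1 & dform (mix r p q) (mix r p q) = x / cinf k.
  apply: mix_ivt => //; apply/orP; left; rewrite m1 ler_pdivlMr // ler_pdivrMr //.
  by rewrite mulrC px mulrC.
exists (mix r p q); split; first exact: prob_vec_mix.
- apply: (le_trans (relent_mix_le r01 hp hq sl Hq)).
  by rewrite lerD2l ler_piMl //; case/andP: r01.
- by rewrite hr mulrC divfK // gt_eqF.
Qed.

(* Coupling two copies of the digit law so that they never share a digit among
   the first j ones: possible since each digit is 1 with probability at most 1/2. *)
Definition coupling1 i (c c' : bool) : R :=
  if c then (if c' then 0 else pr i) else (if c' then pr i else 1 - 2 * pr i).

Definition coupling j k (b b' : bitvec k) : R :=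
  \prod_(i < k) (if (i < j)%N then coupling1 i (b i) (b' i)
                 else bern i (b i) * bern i (b' i)).

Lemma coupling1_ge0 i c c' : 0 <= coupling1 i c c'.
Proof.
by have := pr_gt0 R i; have := pr_le_half R i; rewrite /coupling1; case: c; case: c'; lra.
Qed.

Lemma coupling_ge0 j k (b b' : bitvec k) : 0 <= coupling j b b'.
Proof.
apply: prodr_ge0 => i _; case: ifP => _; first exact: coupling1_ge0.
by rewrite mulr_ge0 ?ltW ?bern_gt0.
Qed.

Lemma couplingC j k (b b' : bitvec k) : coupling j b b' = coupling j b' b.
Proof.
apply: eq_bigr => i _; case: ifP => _; last by rewrite mulrC.
by rewrite /coupling1; case: (b i); case: (b' i).
Qed.

Lemma sum_coupling j k (b : bitvec k) : \sum_b' coupling j b b' = dlaw b.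
Proof.
rewrite (sum_bitvec (fun (i : 'I_k) c => if (i < j)%N then coupling1 i (b i) c
  else bern i (b i) * bern i c)).
apply: eq_bigr => i _; case: (i < j)%N; last by rewrite -mulr_sumr sum_bern mulr1.
by rewrite big_bool /= /coupling1 /bern; case: (b i) => /=; lra.
Qed.

(** As [1 - pr i] is at least 1/2, each coupled digit of a disjoint pair costs at most a factor 4.
    Coupling only [j] digits keeps the constant independent of [k]. *)
Lemma coupling_le j k (b b' : bitvec k) : (j <= k)%N ->
  coupling j b b' * (disj b b')%:R <= 4 ^+ j * (dlaw b * dlaw b' * (disj b b')%:R).
Proof.
move=> jk; case: (boolP (disj b b')) => [/forallP bb'|_]; last by rewrite !mulr0.
rewrite !mulr1 -[4 ^+ j](_ : \prod_(i < k) (if (i < j)%N then 4 else 1) = _); last first.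
  by rewrite -big_mkcond /= -(big_ord_widen k (fun=> 4) jk) prodr_const card_ord.
rewrite /dlaw -!big_split /=; apply: ler_prod => i _.
case: ifP => _; last by rewrite mul1r lexx mulr_ge0 ?ltW ?bern_gt0.
rewrite coupling1_ge0 /=; have := bb' i; have := pr_gt0 R i; have := pr_le_half R i.
by rewrite /coupling1 /bern; case: (b i); case: (b' i) => //= h1 h2 _; nra.
Qed.

Lemma sum_coupling_disj j k : (j <= k)%N ->
  \sum_(b : bitvec k) \sum_b' coupling j b b' * (disj b b')%:R = cseg R j k.
Proof.
move=> jk; under eq_bigr do under eq_bigr do rewrite disjE -big_split /=.
rewrite (sum_bitvec2 (fun (i : 'I_k) c c' => (if (i < j)%N then coupling1 i c c'
  else bern i c * bern i c') * (~~ (c && c'))%:R)).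
rewrite /cseg -prod_tail //; apply: eq_bigr => i _; rewrite !big_bool /=.
by case: (i < j)%N; rewrite /coupling1 /bern /=; ring.
Qed.

(** Let [E] be the set where [p] has density at least [th]; it carries all but [th] of [p]. A small
    form leaves few disjoint pairs inside [E], while the coupling is nearly always disjoint; so its
    two marginals seldom both lie in [E], and the digit law of [E] is at most about 1/2.
    Concentration on such a set costs ln 2. *)
Lemma relent_of_small_dform j k (p : bitvec k -> R) (th : R) : (j <= k)%N -> prob_vec p ->
  0 < th <= 1 ->
  ln 2 <= relent p (@dlaw k) + th * (ln 2 - ln th) + th +
          4 ^+ j * (dform p p / th ^+ 2) + (1 - cseg R j k).
Proof.
move=> jk hp /andP[th0 th1]; have [p0 p1] := hp.
pose E (b : bitvec k) := th * dlaw b <= p b.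
pose nE := \sum_(b | E b) dlaw b.
(* Density 2 on [E] has mass about 1; the value [th] elsewhere keeps the logarithm finite and adds
   at most [th] to the mass. *)
pose q b := (if E b then 2 else th) * dlaw b.
have q0 b : 0 < q b by rewrite mulr_gt0 ?dlaw_gt0 //; case: ifP.
have [d0 d1] := prob_vec_dlaw R k.
have thd : \sum_(b : bitvec k) th * dlaw b = th by rewrite -mulr_sumr d1 mulr1.
have sq : \sum_b q b <= 2 * nE + th.
  rewrite (bigID E) /=; apply: lerD.
    by rewrite mulr_sumr le_eqVlt; apply/orP; left; apply/eqP/eq_bigr => b Eb; rewrite /q Eb.
  rewrite -[leRHS]thd big_mkcond; apply: ler_sum => b _; rewrite /q; case: (E b) => //=.
  by rewrite mulr_ge0 // ltW.
have pEc : \sum_(b | ~~ E b) p b <= th.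
  rewrite -[leRHS]thd big_mkcond; apply: ler_sum => b _; case: ifP => Eb.
    by rewrite ltW // ltNge.
  by rewrite mulr_ge0 // ltW.
have pln : ln 2 - th * (ln 2 - ln th) <= \sum_b p b * ln (q b / dlaw b).
  have lnth : ln th <= 0 by exact: ln_le0.
  have ln2 : 0 <= ln 2 :> R by apply: ln_ge0; rewrite ler1n.
  apply: (@le_trans _ _ (ln 2 - (\sum_(b | ~~ E b) p b) * (ln 2 - ln th))).
    by rewrite lerD2l lerN2 ler_wpM2r //; lra.
  rewrite -[X in X - _]mul1r -{1}p1 !mulr_suml [X in _ - X]big_mkcond -sumrB.
  apply: ler_sum => b _; rewrite /q mulfK ?gt_eqF ?dlaw_gt0 //.
  by case: (E b) => /=; rewrite ?subr0 //; lra.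
have gb := gibbs hp (fun b => ltW (q0 b)) (@dlaw_gt0 R k) (fun b _ => q0 b).
suff nE1 : 2 * nE <= 1 + 4 ^+ j * (dform p p / th ^+ 2) + (1 - cseg R j k) by lra.
have sc : \sum_(b : bitvec k) \sum_b' coupling j b b' = 1.
  by under eq_bigr do rewrite sum_coupling.
have nEl : \sum_(b : bitvec k) \sum_b' coupling j b b' * (E b)%:R = nE.
  under eq_bigr do rewrite -mulr_suml sum_coupling.
  by rewrite /nE [RHS]big_mkcond; apply: eq_bigr => b _; case: (E b); rewrite ?mulr1 ?mulr0.
have nEr : \sum_(b : bitvec k) \sum_b' coupling j b b' * (E b')%:R = nE.
  by rewrite exchange_big /= -nEl; do 2!apply: eq_bigr => ? _; rewrite couplingC.
have -> : 4 ^+ j * (dform p p / th ^+ 2) = \sum_(b : bitvec k) \sum_b' 4 ^+ j * (p b * p b' * (disj b b')%:R / th ^+ 2).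
  rewrite /dform /form mulr_suml mulr_sumr; apply: eq_bigr => b _.
  by rewrite mulr_suml mulr_sumr.
set X := \sum_b _.
have spl (F G : bitvec k -> bitvec k -> R) :
    \sum_b \sum_b' (F b b' + G b b') = \sum_b \sum_b' F b b' + \sum_b \sum_b' G b b'.
  by rewrite -big_split /=; apply: eq_bigr => b _; rewrite big_split.
have : \sum_(b : bitvec k) \sum_b' (coupling j b b' * (E b)%:R + coupling j b b' * (E b')%:R +
      coupling j b b' * (disj b b')%:R) <=
    \sum_(b : bitvec k) \sum_b' (coupling j b b' + coupling j b b' +
      4 ^+ j * (p b * p b' * (disj b b')%:R / th ^+ 2)).
  2: by rewrite !spl nEl nEr sc sum_coupling_disj // -/X; lra.
apply: ler_sum => b _; apply: ler_sum => b' _.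
have cg := coupling_ge0 j b b'; have cl := coupling_le b b' jk.
have h4 : 0 <= 4 ^+ j * (p b * p b' * (disj b b')%:R / th ^+ 2).
  by rewrite !mulr_ge0 ?exprn_ge0 ?invr_ge0 ?exprn_ge0 // ltW.
(* At most two of the three indicators hold unless [b], [b'] are in [E] and disjoint; in that case
   the third copy of the coupling is paid for by [p b * p b' / th ^+ 2]. *)
have [Eb|Eb] := boolP (E b); have [Eb'|Eb'] := boolP (E b'); rewrite ?mulr1 ?mulr0;
  case: (boolP (disj b b')) cl h4 => _; rewrite ?mulr1 ?mulr0 => cl h4; try lra.
suff : 4 ^+ j * (dlaw b * dlaw b') <= 4 ^+ j * (p b * p b' / th ^+ 2) by lra.
rewrite ler_wpM2l ?exprn_ge0 // ler_pdivlMr ?exprn_gt0 // expr2 mulrACA.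
rewrite ![_ * th]mulrC; apply: ler_pM => //; rewrite mulr_ge0 // ltW //.
Qed.

(** Two points that both have digit [i] equal to 1 are never disjoint. *)
Lemma dform_le_bit k (p : bitvec k -> R) (i : 'I_k) : prob_vec p ->
  (\sum_(b : bitvec k | b i) p b) ^+ 2 <= 1 - dform p p.
Proof.
move=> [p0 p1]; have -> : 1 = \sum_b \sum_b' p b * p b' :> R.
  by under eq_bigr do rewrite -mulr_sumr p1 mulr1.
rewrite /dform /form -sumrB expr2 big_distrl /= big_mkcond; apply: ler_sum => b _.
rewrite -sumrB mulr_sumr big_mkcond; case: ifP => bi.
  apply: ler_sum => b' _; case: ifP => bi'; last first.
    by rewrite subr_ge0 ler_piMr ?mulr_ge0 //; case: disj.
  suff /negbTE -> : ~~ disj b b' by rewrite mulr0 subr0.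
  by apply/forallPn; exists i; rewrite bi bi'.
by apply: sumr_ge0 => b' _; rewrite subr_ge0 ler_piMr ?mulr_ge0 //; case: disj.
Qed.

(** Each digit is 1 with [p]-probability at most [e], so [p] gives mass at least 1 - j e to the
    event [Z] that the first [j] digits vanish, whose digit law is the product [h]. The test has
    density 1/h on [Z] and 1 elsewhere; its mass is at most 2, whence the - 1. *)
Lemma relent_of_large_dform j k (p : bitvec k -> R) (e : R) : (j <= k)%N -> prob_vec p ->
  0 <= e -> 1 - e ^+ 2 <= dform p p ->
  - (1 - j%:R * e) * ln (\prod_(i < j) (1 - pr i)) - 1 <= relent p (@dlaw k).
Proof.
move=> jk hp e0 pe; have [p0 p1] := hp; have [d0 d1] := prob_vec_dlaw R k.
pose Z (b : bitvec k) := [forall i : 'I_k, (i < j)%N ==> ~~ b i].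
set h := \prod_(i < j) _.
have h0 : 0 < h by apply: prodr_gt0 => i _; have := pr_le_half R i; lra.
have h1 : h <= 1.
  by apply: prodr_ile1 => i _; have := pr_le_half R i; have := pr_gt0 R i; lra.
have nZ : \sum_(b | Z b) dlaw b = h.
  transitivity (\sum_(b : bitvec k) \prod_(i < k) (if (i < j)%N then (~~ b i)%:R * bern i (b i) else bern i (b i))).
    rewrite big_mkcond; apply: eq_bigr => b _; case: ifP => [/forallP Zb|/negbT/forallPn[i]].
      by apply: eq_bigr => i _; case: ifP => // ij; rewrite (implyP (Zb i) ij) mul1r.
    by rewrite negb_imply negbK => /andP[ij bi]; rewrite (bigD1 i) //= ij bi !mul0r.
  rewrite (sum_bitvec (fun (i : 'I_k) c => if (i < j)%N then (~~ c)%:R * bern i c else bern i c)).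
  rewrite /h (big_ord_widen k (fun i => 1 - pr i) jk) [RHS]big_mkcond; apply: eq_bigr => i _.
  case: (i < j)%N; last exact: sum_bern.
  by rewrite big_bool /= mul0r mul1r add0r.
have pZ : 1 - j%:R * e <= \sum_(b | Z b) p b.
  have bit (i : 'I_k) : \sum_(b : bitvec k | b i) p b <= e.
    have := dform_le_bit i hp; have s0 : 0 <= \sum_(b : bitvec k | b i) p b by exact: sumr_ge0.
    by nra.
  have : \sum_(b | ~~ Z b) p b <= \sum_(i < k | (i < j)%N) \sum_(b : bitvec k | b i) p b.
    rewrite (exchange_big_dep xpredT) //= big_mkcond; apply: ler_sum => b _.
    case: ifP => [/forallPn[i]|_]; last by apply: sumr_ge0.
    rewrite negb_imply negbK => /andP[ij bi]; rewrite (bigD1 i) /= ?ij ?bi //.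
    by rewrite lerDl; apply: sumr_ge0.
  have : \sum_(i < k | (i < j)%N) \sum_(b : bitvec k | b i) p b <= j%:R * e.
    rewrite (_ : j%:R * e = \sum_(i < k | (i < j)%N) e); first by apply: ler_sum => i _; exact: bit.
    by rewrite -(big_ord_widen k (fun=> e) jk) sumr_const card_ord mulr_natl.
  by have := p1; rewrite (bigID Z) /=; lra.
pose q b := (if Z b then h^-1 else 1) * dlaw b.
have q0 b : 0 < q b by rewrite mulr_gt0 ?dlaw_gt0 //; case: ifP; rewrite ?invr_gt0.
have sq : \sum_b q b <= 2.
  rewrite (bigID Z) /= (_ : 2 = 1 + 1) //; apply: lerD.
    rewrite (eq_bigr (fun b => h^-1 * dlaw b)); last by move=> b Zb; rewrite /q Zb.
    by rewrite -mulr_sumr nZ mulVf ?gt_eqF.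
  rewrite -d1 big_mkcond; apply: ler_sum => b _; rewrite /q.
  by case: (Z b); rewrite /= ?mul1r // d0.
have := gibbs hp (fun b => ltW (q0 b)) (@dlaw_gt0 R k) (fun b _ => q0 b).
have -> : \sum_b p b * ln (q b / dlaw b) = - (\sum_(b | Z b) p b) * ln h.
  rewrite mulNr -mulrN mulr_suml [RHS]big_mkcond; apply: eq_bigr => b _.
  rewrite /q mulfK ?gt_eqF ?dlaw_gt0 //; case: (Z b); last by rewrite ln1 mulr0.
  by rewrite lnV.
have lnh : ln h <= 0 by exact: ln_le0.
have : (1 - j%:R * e) * - ln h <= (\sum_(b | Z b) p b) * - ln h.
  by rewrite ler_wpM2r // oppr_ge0.
lra.
Qed.

(** This condition is stable under limits and is what finite-digit estimates provide. The next one
    is exact: [cinf k] is the factor that the form acquires when [p] is extended to a measure on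
    [0,1]. *)
Definition approximable (x t : R) := forall e N, 0 < e ->
  exists k (p : bitvec k -> R), [/\ (N <= k)%N, prob_vec p,
    relent p (@dlaw k) <= t + e & `|dform p p - x| <= e].

Definition attainable (x t : R) := forall e, 0 < e ->
  exists k (p : bitvec k -> R), [/\ prob_vec p,
    relent p (@dlaw k) <= t + e & cinf k * dform p p = x].

Lemma ln2_le_of_approximable t : approximable 0 t -> ln 2 <= t.
Proof.
(* The gap is [5 * d]; four error terms will be at most [d] each. The choices are made in the order
   [th], [j], [e]. *)
move=> H; rewrite leNgt; apply/negP => tl; pose d := (ln 2 - t) / 5.
have d0 : 0 < d by rewrite divr_gt0 // subr_gt0.
have l2 : ln 2 <= 1 :> R by have := @ln_le_subr1 R 2 ltac:(done); lra.
(* With th = u^2, the bound - u ln u <= 1 - u makes - th ln th linear in [u]. *)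
pose u := Num.min 1 (d / 4); pose th := u ^+ 2.
have u0 : 0 < u by rewrite lt_min ltr01 divr_gt0.
have u1 : u <= 1 by rewrite ge_min lexx.
have ud : 4 * u <= d.
  have : u <= d / 4 by rewrite ge_min lexx orbT.
  lra.
have thb : th * (ln 2 - ln th) + th <= d.
  have h : - ln u <= u^-1 - 1 by rewrite -lnV ?posrE //; apply: ln_le_subr1; rewrite invr_gt0.
  have hu : u * - ln u <= 1 - u.
    have : u * - ln u <= u * (u^-1 - 1) by rewrite ler_pM2l.
    by rewrite mulrBr mulr1 divff ?gt_eqF.
  have lt : ln th = 2 * ln u by rewrite /th expr2 lnM ?posrE //; ring.
  rewrite lt /th.
  have : u * (u * - ln u) <= u * (1 - u) by rewrite ler_pM2l.
  have : u ^+ 2 * ln 2 <= u ^+ 2 by rewrite ler_piMr // sqr_ge0.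
  nra.
have th01 : 0 < th <= 1 by rewrite exprn_gt0 //= exprn_ile1 // ltW.
have [j jd] : exists j, forall k, 1 - cseg R j k <= d.
  have [j jd] : exists j : nat, d^-1 <= j%:R :> R.
    by exists (Num.truncn d^-1).+1; exact/ltW/truncnS_gt.
  exists j => k; have := cseg_ge R j k.
  have -> : j.+1%:R / j.+2%:R = 1 - j.+2%:R^-1 :> R.
    by rewrite -!natr1; have j0 : (0 : R) <= j%:R by []; field; lra.
  have : j.+2%:R^-1 <= d.
    rewrite invf_ple ?posrE ?ltr0n //; apply: (le_trans jd); rewrite ler_nat.
    by rewrite -addn2 leq_addr.
  set v := _^-1; lra.
have c0 : 0 < (4 ^+ j / th ^+ 2 : R).
  by case/andP: th01 => t0 _; rewrite divr_gt0 ?exprn_gt0.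
pose e := Num.min d (d / (4 ^+ j / th ^+ 2)).
have e0 : 0 < e by rewrite lt_min d0 divr_gt0.
have [k [p [jk hp pt pF]]] := H e j e0.
have e1 : e <= d by rewrite ge_min lexx.
have e2 : e * (4 ^+ j / th ^+ 2) <= d by rewrite -ler_pdivlMr // ge_min lexx orbT.
have := relent_of_small_dform jk hp th01; have := jd k.
have : 4 ^+ j * (dform p p / th ^+ 2) <= d.
  apply: le_trans e2; rewrite mulrCA ler_pM2r //.
  by move: pF; rewrite subr0 ler_norml => /andP[].
have e5 : 5 * d = ln 2 - t by rewrite /d mulrC divfK ?pnatr_eq0.
lra.
Qed.

(** One digit suffices: the witness is the point mass at digit 1. *)
Lemma attainable0 t : ln 2 <= t -> attainable 0 t.
Proof.
move=> lt e e0; exists 1, (push1 (@dlaw 1)); split.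
- exact/prob_vec_push1/prob_vec_dlaw.
- apply: (le_trans (relent_push1 (prob_vec_dlaw R 1))).
  have -> : relent (@dlaw 1) (@dlaw 1) = 0.
    by rewrite /relent big1 // => b _; rewrite divff ?gt_eqF ?dlaw_gt0 // ln1 mulr0.
  lra.
- by rewrite dform_push1_push1 mulr0.
Qed.

Lemma approximable1 t : ~ approximable 1 t.
Proof.
(* With j e' <= 1/2 at least half of - ln h survives, so the entropy exceeds (t + 3) - 1, whereas it
   should be at most t + 1. *)
move=> H; have [j hj] := @prod_1Bpr_small R (expR (- (2 * (t + 3)))) (expR_gt0 _).
set h := \prod_(i < j) _ in hj.
have h0 : 0 < h by apply: prodr_gt0 => i _; have := pr_le_half R i; lra.
have lh : 2 * (t + 3) < - ln h.
  by rewrite -ltrN2 opprK -(expRK (- (2 * _))) ltr_ln ?posrE ?expR_gt0.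
pose e' : R := (2 * j.+1%:R)^-1.
have e'0 : 0 < e' by rewrite invr_gt0 mulr_gt0.
have je : j%:R * e' <= 2^-1.
  rewrite ler_pdivrMr ?mulr_gt0 // mulrA mulVf ?pnatr_eq0 // mul1r ler_nat.
  exact: leqnSn.
pose e := Num.min 1 (e' ^+ 2).
have e0 : 0 < e by rewrite lt_min ltr01 exprn_gt0.
have [k [p [jk hp pt pF]]] := H e j e0.
have e1 : e <= 1 by rewrite ge_min lexx.
have e2 : e <= e' ^+ 2 by rewrite ge_min lexx orbT.
have pF' : 1 - e' ^+ 2 <= dform p p.
  by move: pF; rewrite ler_norml => /andP[]; lra.
have := relent_of_large_dform jk hp (ltW e'0) pF'; rewrite -/h.
have h1 : 0 <= - ln h.
  rewrite oppr_ge0; apply: ln_le0; apply: prodr_ile1 => i _.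
  by have := pr_le_half R i; have := pr_gt0 R i; lra.
have : 2^-1 * - ln h <= (1 - j%:R * e') * - ln h by rewrite ler_wpM2r //; lra.
lra.
Qed.

Lemma approximable_attainable x t : 0 <= x <= 1 -> approximable x t -> attainable x t.
Proof.
move=> /andP[x0 x1] H.
have [x00|xn0] := eqVneq x 0.
  by subst x; apply: attainable0; exact: ln2_le_of_approximable.
have [x11|xn1] := eqVneq x 1; first by subst x; case: (@approximable1 t).
have {}x0 : 0 < x by rewrite lt_def xn0.
have {}x1 : 0 < 1 - x by rewrite subr_gt0 lt_neqAle xn1.
move=> e e0.
have [m [m0 m1 m2]] : exists m : nat, [/\ (0 < m)%N, 2 <= m%:R * (1 - x) & 8 <= e * (m%:R * (1 - x))].
  pose B := 2 / (1 - x) + 8 / (e * (1 - x)).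
  have B1 : 0 < 2 / (1 - x) by rewrite divr_gt0.
  have B2 : 0 < 8 / (e * (1 - x)) by rewrite divr_gt0 // mulr_gt0.
  exists (Num.truncn B).+1; have Bm := truncnS_gt B.
  set m := _.+1 in Bm *; have mR : 2 / (1 - x) <= m%:R by rewrite /B in Bm; lra.
  have mR' : 8 / (e * (1 - x)) <= m%:R by rewrite /B in Bm; lra.
  split => //; first by rewrite -ler_pdivrMr.
  by rewrite mulrCA -ler_pdivrMr // mulr_gt0.
have mR : 1 <= m%:R :> R by rewrite ler1n.
(* A square, so that ln (j + 1) = 2 ln m is at most 2m. Against [s] of order 1/m^2 the cost is at
   most 4/(m (1 - x)), hence at most e/2. *)
pose j := (m ^ 2).-1.
have jm : j.+1 = (m ^ 2)%N by rewrite prednK // expn_gt0 m0.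
have jmR : j.+1%:R = m%:R ^+ 2 :> R by rewrite jm natrX.
(* Here s (1 - x) = 2/(j + 1): one share makes up for the approximation error of the form, the other
   for the resampling factor (j + 1)/(j + 2). *)
pose s := 2 / (m%:R ^+ 2 * (1 - x)).
have m2x : 0 < m%:R ^+ 2 * (1 - x) by rewrite mulr_gt0 // exprn_gt0 // (lt_le_trans ltr01).
have s01 : 0 <= s <= 1.
  by rewrite divr_ge0 ?(ltW m2x) //= ler_pdivrMr // mul1r expr2 -mulrA; nra.
have sln : s * ln j.+1%:R <= e / 2.
  have lm : ln (m%:R ^+ 2) <= 2 * m%:R :> R.
    rewrite expr2 lnM ?posrE ?(lt_le_trans ltr01) //.
    by have := @ln_le_subr1 R m%:R (lt_le_trans ltr01 mR); lra.
  rewrite jmR; apply: (@le_trans _ _ (s * (2 * m%:R))).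
    by rewrite ler_wpM2l //; case/andP: s01.
  rewrite /s mulrAC ler_pdivrMr //; nra.
(* The three bounds serve the entropy, the raising move, and the lowering move, whose square root
   must be at most e/2. *)
pose eps := Num.min (e / 2) (Num.min j.+1%:R^-1 (x * (e / 2) ^+ 2)).
have eps0 : 0 < eps by rewrite !lt_min divr_gt0 // invr_gt0 ltr0Sn mulr_gt0 // exprn_gt0 // divr_gt0.
have ee : eps <= e / 2 by rewrite ge_min lexx.
have ej : eps <= j.+1%:R^-1 by rewrite !ge_min lexx orbT.
have ex : eps <= x * (e / 2) ^+ 2 by rewrite !ge_min lexx !orbT.
(* [j.+1] guarantees a first digit, which the lowering move sets. *)
have [k [p [jk hp pt]]] := H eps j.+1 eps0; rewrite ler_norml => /andP[pF1 pF2].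
have [xF|xF] := leP x (cinf k * dform p p); last first.
  have [] := @raise_dform j k s p x (ltnW jk) hp s01 (ltW xF).
    have cj := cinf_ge R j.
    have bnd : x <= j.+1%:R / j.+2%:R * (1 - (1 - s) ^+ 2 * (1 - dform p p)).
      rewrite mulrAC ler_pdivlMr ?ltr0n //.
      pose a : R := j.+1%:R^-1; have a0 : 0 < a by rewrite invr_gt0 ltr0Sn.
      have j2 : j.+2%:R = j.+1%:R * (1 + a) :> R.
        by rewrite mulrDr mulr1 /a divff ?pnatr_eq0 // natr1.
      rewrite j2 mulrCA ler_pM2l ?ltr0Sn //.
      have sx : s * (1 - x) = 2 * a.
        rewrite /s /a jmR; field; rewrite gt_eqF ?(lt_le_trans ltr01) //=.
        by rewrite gt_eqF.
      have F1 := form_le1 (@disj k) hp; rewrite -/(dform p p) in F1.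
      have : (1 - s) ^+ 2 * (1 - dform p p) <= (1 - s) * (1 - x + a).
        case/andP: s01 => s0 s1; rewrite expr2 -mulrA ler_wpM2l ?subr_ge0 //.
        have Fxa : x - a <= dform p p by move: ej; rewrite -/a; lra.
        nra.
      by case/andP: s01 => s0 s1; nra.
    apply: (le_trans bnd); rewrite ler_wpM2r // subr_ge0.
    have F1 := form_le1 (@disj k) hp; rewrite -/(dform p p) in F1.
    have F0 : 0 <= dform p p by case: hp => p0 _; exact: form_ge0.
    by case/andP: s01 => s0 s1; rewrite mulr_ile1 ?sqr_ge0 ?exprn_ile1 //; lra.
  move=> q [hq qH qF]; exists k, q; split => //.
  by lra.
case: k p jk hp pt pF1 pF2 xF => // k p jk hp pt pF1 pF2 xF.
have c0 := cinf_gt0 R k.+1; have c1 := cinf_le1 R k.+1.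
have cF0 : 0 < cinf k.+1 * dform p p by exact: lt_le_trans xF.
have F0 : 0 < dform p p by rewrite -(pmulr_rgt0 _ c0).
have [q [hq qH qF]] := lower_dform hp (ltW x0) F0 xF.
exists k.+1, q; split => //.
suff : Num.sqrt (1 - x / (cinf k.+1 * dform p p)) * ln 2 <= e / 2 by lra.
have l2 : ln 2 <= 1 :> R by have := @ln_le_subr1 R 2 ltac:(done); lra.
apply: (@le_trans _ _ (Num.sqrt (1 - x / (cinf k.+1 * dform p p)))).
  by rewrite ler_piMr // sqrtr_ge0.
have e2 : 0 <= e / 2 by rewrite divr_ge0 // ltW.
rewrite -[leRHS]ger0_norm // -sqrtr_sqr ler_sqrt ?sqr_ge0 //.
have cF : cinf k.+1 * dform p p <= x + eps.
  by apply: (@le_trans _ _ (dform p p)); [rewrite ler_piMl // ltW | lra].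
rewrite lerBlDr -lerBlDl; rewrite ler_pdivlMr //.
set D := _ * dform p p in cF0 xF cF *; set E := (e / 2) ^+ 2 in ex *.
have E0 : 0 <= E by exact: sqr_ge0.
nra.
Qed.

End Approximation.

(** * Digits of real numbers *)

Section Digits.
Variable R : realType.
Implicit Types (k : nat).

Lemma measurable_digit k : measurable [set a : R | digit a k].
Proof.
pose F (z : int) := if odd `|z|%N then
  (fun a : R => a * 2 ^+ k.+1) @^-1` `[z%:~R, (z + 1)%:~R[ `\ 1 else set0.
have -> : [set a : R | digit a k] = [set 1] `|` \bigcup_z F z.
  apply/seteqP; split => a; rewrite /= /digit.
    have [->|a1 oa] := eqVneq a 1; first by left.
    right; exists (Num.floor (a * 2 ^+ k.+1)) => //=; rewrite /F oa; split; last exact/eqP.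
    by rewrite /= in_itv /= floor_itv.
  move=> [->|[z _]]; first by rewrite eqxx.
  rewrite /F; case: ifP => // oz [az /eqP a1].
  by rewrite (negbTE a1); move: az; rewrite /= in_itv /= => /floor_def ->.
apply: measurableU => //; apply: countable_bigcupT_measurable => // z.
rewrite /F; case: ifP => // _; apply: measurableD => //.
rewrite -[X in measurable X]setTI.
by apply: (measurable_funM (@measurable_id _ _ _) (@measurable_cst _ _ _ _ _ _)).
Qed.

Definition bits k (a : R) : bitvec k := [ffun i : 'I_k => digit a i].

Definition cyl k (b : bitvec k) : set R := [set a | bits k a = b].

Lemma measurable_cyl k (b : bitvec k) : measurable (cyl b).
Proof.
have -> : cyl b = \bigcap_(i in [set` [set: 'I_k]%SET])
    (if b i then [set a : R | digit a i] else ~` [set a | digit a i]).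
  apply/seteqP; split => [a <- i _|a h]; first by rewrite ffunE; case: ifP => //= ->.
  apply/ffunP => i; rewrite ffunE; have := h i; rewrite /= inE => /(_ isT).
  by case: (b i) => //= /negP/negbTE.
apply: fin_bigcap_measurable => // i _.
by case: ifP => _; [|apply: measurableC]; exact: measurable_digit.
Qed.

Lemma simple_bits k (phi : bitvec k -> R) :
  (fun u => phi (bits k u)) = (fun u => \sum_b phi b * \1_(cyl b) u).
Proof.
apply/funext => u; rewrite (bigD1 (bits k u)) //= indicE mem_set // mulr1.
by rewrite big1 ?addr0 // => b /eqP bu; rewrite indicE memNset ?mulr0 // => /esym.
Qed.

Lemma measurable_bits k (phi : bitvec k -> R) :
  measurable_fun setT (fun u => phi (bits k u)).
Proof.
rewrite simple_bits; apply: measurable_sum => b; apply: measurable_funM => //.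
by apply: measurable_indic; exact: measurable_cyl.
Qed.

(** * The form of a measure as the limit of the forms of its digit laws *)

Section Law.
Variable mu : probability R R.

Definition blaw k (b : bitvec k) : R := fine (mu (cyl b)).

Lemma blawE k (b : bitvec k) : (blaw b)%:E = mu (cyl b).
Proof. by rewrite fineK // fin_num_measure //; exact: measurable_cyl. Qed.

Lemma integrable_bits k (phi : bitvec k -> R) :
  mu.-integrable setT (fun u => (phi (bits k u))%:E).
Proof.
under eq_fun do rewrite (congr1 (@^~ _) (simple_bits phi)) -sumEFin.
apply: integrable_sum => // b _.
under eq_fun do rewrite EFinM.
apply: integrableZl => //; apply: integrable_indic => //; exact: measurable_cyl.
Qed.

Lemma integral_bits k (phi : bitvec k -> R) :
  (\int[mu]_u (phi (bits k u))%:E = (\sum_b blaw b * phi b)%:E)%E.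
Proof.
under eq_integral do rewrite (congr1 (@^~ _) (simple_bits phi)) -sumEFin.
rewrite integral_sum //; last first.
  move=> b; under eq_fun do rewrite EFinM.
  apply: integrableZl => //; apply: integrable_indic => //; exact: measurable_cyl.
rewrite -sumEFin; apply: eq_bigr => b _.
under eq_integral do rewrite EFinM.
rewrite integralZl //; last by apply: integrable_indic => //; exact: measurable_cyl.
rewrite integral_indic //; last exact: measurable_cyl.
by rewrite setIT EFinM blawE muleC.
Qed.

Lemma prob_vec_blaw k : prob_vec (@blaw k).
Proof.
split=> [b|]; first by rewrite fine_ge0.
have := @integral_bits k (fun=> 1).
have -> : (\int[mu]__ 1 = 1)%E.
  by rewrite integral_cst //= mul1e; exact: probability_setT.
by move=> -[->]; apply: eq_bigr => b _; rewrite mulr1.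
Qed.

Lemma fdig_le1 (u v : R) : 0 <= fdig u v <= 1.
Proof. by rewrite /fdig; case: asboolP; rewrite ?ler01 ?lexx. Qed.

Lemma disj_bitsP k (u v : R) :
  reflect (forall i, (i < k)%N -> ~~ (digit u i && digit v i)) (disj (bits k u) (bits k v)).
Proof.
apply: (iffP forallP) => [h i ik|h i]; last by rewrite !ffunE h.
by have := h (Ordinal ik); rewrite !ffunE.
Qed.

Lemma cvg_disj_bits (u v : R) :
  ((disj (bits k u) (bits k v))%:R : R) @[k --> \oo] --> fdig u v.
Proof.
rewrite /fdig; case: asboolP => [h|/existsNP[i /negP]].
  apply: cvg_near_cst; apply: nearW => k.
  by have -> : disj (bits k u) (bits k v) by apply/disj_bitsP => i _; exact: h.
rewrite negbK => hi; apply: cvg_near_cst; near=> k.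
rewrite (_ : disj _ _ = false) //; apply/negP => /disj_bitsP/(_ i).
rewrite hi; have -> : (i < k)%N by near: k; exact: nbhs_infty_gt.
by move=> /(_ isT).
Unshelve. all: by end_near. Qed.

Lemma measurable_fdig (u : R) : measurable_fun setT (fdig u).
Proof.
apply: (@measurable_fun_cvg _ _ _ _
   (fun k v => (disj (bits k u) (bits k v))%:R)) => [k|v _].
  exact: (measurable_bits (fun b => (disj (bits k u) b)%:R)).
exact: cvg_disj_bits.
Qed.

Lemma integrable_fdig (u : R) : mu.-integrable setT (fun v => (fdig u v)%:E).
Proof.
apply: (@le_integrable _ _ _ mu setT measurableT _ (EFin \o cst 1)).
- apply/measurable_EFinP; exact: measurable_fdig.
- by move=> v _ /=; rewrite lee_fin normr1 ger0_norm; case/andP: (fdig_le1 u v).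
- exact: finite_measure_integrable_cst.
Qed.

Definition fsec u : R := fine (\int[mu]_v (fdig u v)%:E)%E.

Lemma fsecE u : (\int[mu]_v (fdig u v)%:E)%E = (fsec u)%:E.
Proof. by rewrite fineK //; apply: integrable_fin_num => //; exact: integrable_fdig. Qed.

Definition dsec k u : R := \sum_b blaw b * (disj (bits k u) b)%:R.

Lemma dsec_bounds k u : 0 <= dsec k u <= 1.
Proof.
have [p0 p1] := prob_vec_blaw k; apply/andP; split.
  by apply: sumr_ge0 => b _; rewrite mulr_ge0.
by rewrite -p1; apply: ler_sum => b _; rewrite ler_piMr //; case: disj.
Qed.

Lemma integral_dsec_sec k u :
  (\int[mu]_v (disj (bits k u) (bits k v))%:R%:E)%E = (dsec k u)%:E.
Proof. exact: (integral_bits (fun b => (disj (bits k u) b)%:R)). Qed.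

Lemma cvg_dsec u : dsec k u @[k --> \oo] --> fsec u.
Proof.
suff /fine_cvgP[_] : (dsec k u)%:E @[k --> \oo] --> (fsec u)%:E by [].
rewrite -fsecE; under eq_fun do rewrite -integral_dsec_sec.
apply: (@dominated_cvg _ _ _ mu setT measurableT
  (fun k v => (disj (bits k u) (bits k v))%:R%:E) _ (EFin \o cst 1)) => //.
- by move=> k; apply/measurable_EFinP; exact: (measurable_bits (fun b => (disj (bits k u) b)%:R)).
- move=> v _; apply: cvg_EFin; first by apply: nearW.
  exact: cvg_disj_bits.
- exact: finite_measure_integrable_cst.
- by move=> k v _; rewrite /= lee_fin normr_nat; case: disj; rewrite ?ler01.
Qed.

Lemma integral_dsec k : (\int[mu]_u (dsec k u)%:E)%E = (dform (@blaw k) (@blaw k))%:E.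
Proof.
rewrite (integral_bits (fun c => \sum_b blaw b * (disj c b)%:R)); congr EFin.
rewrite /dform /form; apply: eq_bigr => b _; rewrite mulr_sumr.
by apply: eq_bigr => b' _; rewrite mulrA.
Qed.

(** Dominated convergence twice, in v for fixed u and then in u, each time along functions of
    finitely many digits. *)
Lemma cvg_dform_blaw_fsec : (dform (@blaw k) (@blaw k))%:E @[k --> \oo] -->
  (\int[mu]_u \int[mu]_v (fdig u v)%:E)%E.
Proof.
under eq_fun do rewrite -integral_dsec; under eq_integral do rewrite fsecE.
apply: (@dominated_cvg _ _ _ mu setT measurableT
  (fun k u => (dsec k u)%:E) _ (EFin \o cst 1)) => //.
- move=> k; apply/measurable_EFinP.
  exact: (measurable_bits (fun c => \sum_b blaw b * (disj c b)%:R)).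
- move=> u _; apply: cvg_EFin; first by apply: nearW.
  exact: cvg_dsec.
- exact: finite_measure_integrable_cst.
- by move=> k u _; rewrite /= lee_fin; case/andP: (dsec_bounds k u) => d0 d1; rewrite ger0_norm.
Qed.

Lemma fdig_integral_le1 x : (\int[mu]_u \int[mu]_v (fdig u v)%:E = x%:E)%E ->
  0 <= x <= 1.
Proof.
move=> e; have := cvg_dform_blaw_fsec; rewrite e => /fine_cvgP[_ h].
have hp k := prob_vec_blaw k; apply/andP; split.
  rewrite -(cvg_lim _ h) //; apply: limr_ge; first exact: cvgP h.
  by apply: nearW => k; apply: form_ge0 => b; exact: (hp k).1.
rewrite -(cvg_lim _ h) //; apply: limr_le; first exact: cvgP h.
by apply: nearW => k; exact: form_le1.
Qed.

End Law.

(** * Integration against a density *)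

Section Density.
Variables (mu nu : probability R R) (g : R -> R).
Hypothesis hg : is_density mu nu g.

Let mg : measurable_fun setT (EFin \o g).
Proof. by case: hg => h _ _; exact/measurable_EFinP. Qed.

Let g0 x : 0 <= g x. Proof. by case: hg. Qed.

Lemma integral_density_indic (A : set R) : measurable A ->
  (\int[mu]_x (\1_A x)%:E = \int[nu]_x ((\1_A x)%:E * (g x)%:E))%E.
Proof.
move=> mA; rewrite integral_indic // setIT; case: hg => _ _ /(_ A mA) e.
etransitivity; first exact: e.
rewrite [LHS]integral_mkcond; apply: eq_integral => x _.
rewrite /restrict indicE; case: (x \in A); rewrite ?mul1e ?mul0e //.
Qed.

Import HBNNSimple.

Lemma integral_density_nnsfun (h : {nnsfun R >-> R}) :
  (\int[mu]_x (h x)%:E = \int[nu]_x ((h x)%:E * (g x)%:E))%E.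
Proof.
have mind (r : R) : measurable (h @^-1` [set r]) by exact: measurable_sfunP.
have m1 (r : R) : measurable_fun setT (fun x => (\1_(h @^-1` [set r]) x)%:E : \bar R).
  by apply/measurable_EFinP; apply: measurable_indic.
transitivity (\sum_(r \in range h) r%:E * \int[mu]_x (\1_(h @^-1` [set r]) x)%:E)%E.
  under eq_integral do rewrite fimfunE -fsumEFin //.
  rewrite ge0_integral_fsum //.
  - by apply: eq_fsbigr => r _; under eq_integral do rewrite EFinM; rewrite integralZl_indic_nnsfun.
  - by move=> r; under eq_fun do rewrite EFinM; exact: measurable_funeM.
  - by move=> r x _; exact: nnfun_muleindic_ge0.
transitivity (\sum_(r \in range h) \int[nu]_x ((r * \1_(h @^-1` [set r]) x)%:E * (g x)%:E))%E; last first.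
  rewrite -ge0_integral_fsum //.
  - apply: eq_integral => x _; rewrite -ge0_mule_fsuml; last by move=> r; exact: nnfun_muleindic_ge0.
    by rewrite fsumEFin // -fimfunE.
  - by move=> r; apply: emeasurable_funM => //; under eq_fun do rewrite EFinM; exact: measurable_funeM.
  - by move=> r x _; apply: mule_ge0; [exact: nnfun_muleindic_ge0 | rewrite lee_fin].
apply: eq_fsbigr => r; rewrite inE => -[x _ hr].
rewrite integral_density_indic // -ge0_integralZl //.
- by apply: eq_integral => y _; rewrite EFinM muleA.
- exact: emeasurable_funM.
- by move=> y _; rewrite mule_ge0 ?lee_fin.
- by rewrite lee_fin -hr.
Qed.

Lemma integral_density (f : R -> \bar R) : measurable_fun setT f ->
  (forall x, 0 <= f x)%E -> (\int[mu]_x f x = \int[nu]_x (f x * (g x)%:E))%E.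
Proof.
move=> mf f0; pose h := nnsfun_approx measurableT mf.
have hf x : (EFin \o h^~ x) n @[n --> \oo] --> f x by exact: cvg_nnsfun_approx.
have hmono x : {homo (fun n => (h n x)%:E) : n m / (n <= m)%N >-> (n <= m)%E}.
  by move=> a b ab; rewrite lee_fin; exact/lefP/nd_nnsfun_approx.
transitivity (limn (fun n => \int[mu]_x (h n x)%:E)%E).
  rewrite -monotone_convergence //.
  - by apply: eq_integral => x _; apply/esym/cvg_lim => //; exact: hf.
  - by move=> n; exact/measurable_EFinP.
  - by move=> n x _; rewrite lee_fin.
under eq_fun do rewrite integral_density_nnsfun.
rewrite -monotone_convergence //.
- apply: eq_integral => x _; apply/cvg_lim => //.
  by apply: cvgeZr => //; exact: hf.
- by move=> n; apply: emeasurable_funM => //; exact/measurable_EFinP.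
- by move=> n x _; rewrite mule_ge0 ?lee_fin.
- by move=> x _ a b ab; apply: lee_wpmul2r; rewrite ?lee_fin // -lee_fin; exact: hmono.
Qed.

End Density.

End Digits.

(** * The rate function *)

Section Lift.
Variables (R : realType) (nu : probability R R) (g : R -> R).
Hypotheses (mg : measurable_fun setT g) (g0 : forall x, 0 <= g x).
Hypothesis g1 : (\int[nu]_x (g x)%:E = 1)%E.

Definition density_measure (A : set R) : \bar R := (\int[nu]_(x in A) (g x)%:E)%E.

Let dm0 : density_measure set0 = 0%E.
Proof. by rewrite /density_measure integral_set0. Qed.

Let dm_ge0 A : (0 <= density_measure A)%E.
Proof. by apply: integral_ge0 => x _; rewrite lee_fin. Qed.

Let dm_sigma : semi_sigma_additive density_measure.
Proof.
move=> A mA tA mUA; rewrite /density_measure ge0_integral_bigcup //.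
- apply: is_cvg_ereal_nneg_natsum_cond => n _ _; exact: dm_ge0.
- by apply/measurable_EFinP; apply: measurable_funTS.
- by move=> x _; rewrite lee_fin.
Qed.

HB.instance Definition _ := isMeasure.Build _ _ _ density_measure dm0 dm_ge0 dm_sigma.

HB.instance Definition _ := @Measure_isProbability.Build _ _ R density_measure g1.

Definition density_prob : probability R R := density_measure.

End Lift.

Lemma exists_density (R : realType) (nu : probability R R) (g : R -> R) :
  measurable_fun setT g -> (forall x, 0 <= g x) -> (\int[nu]_x (g x)%:E = 1)%E ->
  exists mu : probability R R, is_density mu nu g.
Proof. by move=> mg g0 g1; exists (density_prob mg g0 g1). Qed.

(** * The rate function in terms of digit laws *)

Section DigitMeasure.
Variables (R : realType) (nu : probability R R).
Hypothesis hnu : is_prime_digit_measure nu.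
Local Notation bern := (bern R).
Local Notation dlaw := (@dlaw R).

Lemma nu_I01 : nu (@I01 R) = 1%E.
Proof.
have := hnu 0 (fun=> false); rewrite big_ord0 => <-; congr (nu _).
by apply/seteqP; split => [a ha|a []].
Qed.

Lemma measurable_I01 : measurable (@I01 R).
Proof.
have -> : @I01 R = `[0, 1]%classic by apply/seteqP; split => x; rewrite /= in_itv.
exact: measurable_itv.
Qed.

Lemma nu_I01C : nu (~` @I01 R) = 0%E.
Proof. by rewrite probability_setC ?nu_I01 ?subee //; exact: measurable_I01. Qed.

Lemma blaw_nu k (b : bitvec k) : blaw nu b = dlaw b.
Proof.
apply: EFin_inj; rewrite blawE.
pose b' i := if insub i is Some j then b j else false.
have bE (i : 'I_k) : b' i = b i by rewrite /b' valK.
have -> : nu (cyl b) = nu (I01 (R := R) `&` cyl b).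
  have mc : measurable (@cyl R _ b) := measurable_cyl b; have mI := measurable_I01.
  apply/eqP; rewrite eq_le; apply/andP; split; last first.
    by apply: le_measure; rewrite ?inE //; exact: measurableI.
  rewrite -[leRHS]adde0 -nu_I01C.
  apply: le_trans (measureU2 _ _ _) => //; last by exact: measurableC.
    apply: le_measure; rewrite ?inE //.
      by apply: measurableU; [exact: measurableI | exact: measurableC].
    by move=> x cx; have [?|?] := pselect (I01 x); [left|right].
  exact: measurableI.
transitivity (nu [set a | I01 a /\ forall i, (i < k)%N -> digit a i = b' i]).
  congr (nu _); apply/seteqP; split => a [Ia h]; split => //.
    move=> i ik; have := bE (Ordinal ik); rewrite /= => ->.
    by rewrite -(h : bits k a = b) ffunE.
  by apply/ffunP => i; rewrite ffunE h ?bE.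
rewrite hnu; congr EFin; apply: eq_bigr => i _.
by rewrite bE /bern /pr; case: (b i).
Qed.

Section LiftBits.
Variables (k : nat) (p : bitvec k -> R).
Hypothesis hp : prob_vec p.

(** The density that gives the first [k] digits the law [p] and leaves the other digits independent
    with their law under nu. *)
Definition lift_density (u : R) : R := p (bits k u) / dlaw (bits k u).

Lemma lift_density_ge0 u : 0 <= lift_density u.
Proof. by rewrite divr_ge0 ?hp.1 // ltW ?dlaw_gt0. Qed.

Lemma measurable_lift_density : measurable_fun setT lift_density.
Proof. exact: (measurable_bits (fun b => p b / dlaw b)). Qed.

Lemma integral_lift_density : (\int[nu]_u (lift_density u)%:E = 1)%E.
Proof.
rewrite (integral_bits nu (fun b => p b / dlaw b)) -hp.2; congr EFin.
apply: eq_bigr => b _.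
by rewrite blaw_nu mulrC divfK // gt_eqF ?dlaw_gt0.
Qed.

Definition prefix m (km : (k <= m)%N) (b : bitvec m) : bitvec k :=
  [ffun i => b (widen_ord km i)].

Definition extend m (a : bitvec k) : bitvec m :=
  [ffun i : 'I_m => if insub (i : nat) is Some j then a j else false].

Lemma prefix_bits m (km : (k <= m)%N) (u : R) : prefix km (bits m u) = bits k u :> bitvec k.
Proof. by apply/ffunP => i; rewrite !ffunE. Qed.

Variable mu : probability R R.
Hypothesis hmu : is_density mu nu lift_density.

Lemma blaw_lift m (km : (k <= m)%N) (b : bitvec m) :
  blaw mu b = p (prefix km b) * (dlaw b / dlaw (prefix km b)).
Proof.
apply: EFin_inj; rewrite blawE; case: hmu => _ _ e.
have mc : measurable (@cyl R _ b) := measurable_cyl b; etransitivity; first exact: e.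
rewrite (eq_integral (cst (p (prefix km b) / dlaw (prefix km b))%:E)); last first.
  by move=> u; rewrite inE /= => <-; rewrite prefix_bits.
by rewrite integral_cst // -[X in (_ * X)%E](blawE nu) blaw_nu -EFinM; congr EFin; rewrite mulrA mulrAC.
Qed.

(** Extension by independent digits is the kernel applied to zero-padded prefixes, which brings it
    under [dform_kern]. *)
Lemma blaw_lift_kern m (km : (k <= m)%N) (b : bitvec m) :
  blaw mu b = \sum_a p a * kern R k (extend m a) b.
Proof.
rewrite (blaw_lift km) (bigD1 (prefix km b)) //= [X in _ = _ + X]big1 ?addr0; last first.
  move=> a /eqP ab; have [i hi] : exists i : 'I_k, b (widen_ord km i) != a i.
    apply/existsP; apply: contra_notT ab => /existsPn h; apply/ffunP => i.
    by rewrite ffunE; have := h i; rewrite negbK => /eqP.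
  rewrite /kern (bigD1 (widen_ord km i)) //= ltn_ord ffunE /= valK (negbTE hi).
  by rewrite mul0r mulr0.
congr (_ * _); apply: (canLR (mulfK _)); first by rewrite gt_eqF ?dlaw_gt0.
pose F i := bern i (if insub i is Some j then b j else false).
have -> : dlaw (prefix km b) = \prod_(i < k) F i.
  apply: eq_bigr => i _; rewrite ffunE /F; congr (bern _ _).
  by rewrite -[nat_of_ord i]/(nat_of_ord (widen_ord km i)) valK.
rewrite (big_ord_widen m F km) /kern /dlaw [X in _ * X]big_mkcond -big_split /=.
apply: eq_bigr => i _; rewrite /F valK; case: ifP => ik; last by rewrite mulr1.
rewrite !ffunE insubT !ffunE /=.
suff -> : widen_ord km (Sub (val i) ik) = i by rewrite eqxx mul1r.
exact: val_inj.
Qed.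

Lemma dform_blaw_lift m : (k <= m)%N ->
  dform (@blaw R mu m) (@blaw R mu m) = dform p p * cseg R k m.
Proof.
move=> km; have -> : @blaw R mu m = (fun b => \sum_a p a * kern R k (extend m a) b).
  by apply/funext => b; exact: blaw_lift_kern.
rewrite dform_kern //; congr (_ * _); apply: eq_bigr => a _; apply: eq_bigr => a' _.
congr (_ * (nat_of_bool _)%:R); apply/forallP/forallP => h i.
  by have /implyP/(_ (ltn_ord i)) := h (widen_ord km i); rewrite !ffunE /= valK.
by apply/implyP => ik; have := h (Ordinal ik); rewrite !ffunE !insubT.
Qed.

Lemma fdig_integral_lift : (\int[mu]_u \int[mu]_v (fdig u v)%:E = (cinf R k * dform p p)%:E)%E.
Proof.
have h1 := @cvg_dform_blaw_fsec R mu.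
apply: (cvg_unique _ h1) => //; apply: cvg_EFin; first exact: nearW.
rewrite mulrC; apply: (@cvg_trans _ (dform p p * cseg R k m @[m --> \oo])); last first.
  by apply: cvgMr; exact: cvg_cseg.
apply: near_eq_cvg; near=> m; rewrite /= dform_blaw_lift //.
by near: m; exact: nbhs_infty_ge.
Unshelve. all: by end_near. Qed.

Lemma integral_ln_lift :
  mu.-integrable setT (fun x => (ln (lift_density x))%:E) /\
  (\int[mu]_x (ln (lift_density x))%:E = (relent p (@dlaw k))%:E)%E.
Proof.
split; first exact: (integrable_bits mu (fun b => ln (p b / dlaw b))).
rewrite (integral_bits mu (fun b => ln (p b / dlaw b))) /relent; congr EFin.
apply: eq_bigr => b _; rewrite (blaw_lift (leqnn k)).
have -> : prefix (leqnn k) b = b.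
  by apply/ffunP => i; rewrite ffunE; congr (b _); exact: val_inj.
by rewrite divff ?mulr1 // gt_eqF ?dlaw_gt0.
Qed.

Lemma I01_lift : mu (@I01 R) = 1%E.
Proof.
have mI := measurable_I01; case: hmu => _ _ e; etransitivity; first exact: (e _ mI).
rewrite -integral_lift_density -[in RHS](setUv (@I01 R)).
rewrite ge0_integral_setU //; last 4 first.
- exact: measurableC.
- by rewrite setUv; apply/measurable_EFinP; exact: measurable_lift_density.
- by move=> x _; rewrite lee_fin lift_density_ge0.
- exact/disj_setPCl.
rewrite [X in (_ + X)%E]null_set_integral ?adde0 //.
- exact: measurableC.
- by apply/measurable_EFinP; apply: measurable_funTS; exact: measurable_lift_density.
- exact: nu_I01C.
Qed.

End LiftBits.

Lemma rate_I1_lift k (p : bitvec k -> R) : prob_vec p ->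
  (rate_I1 nu (cinf R k * dform p p) <= (relent p (@dlaw k))%:E)%E.
Proof.
move=> hp; have [mu hmu] := exists_density (measurable_lift_density p)
  (lift_density_ge0 hp) (integral_lift_density hp).
have [int eq] := integral_ln_lift hmu.
rewrite /rate_I1; apply: (@le_trans _ _ (rel_entropy mu nu)).
  apply: ereal_inf_lbound; exists mu => //; split; first exact: I01_lift hmu.
  exact: fdig_integral_lift hmu.
rewrite -eq; apply: ereal_inf_lbound; exists (lift_density p) => //.
Qed.

Lemma attainable_rate_I1 x t : attainable x t -> (rate_I1 nu x <= t%:E)%E.
Proof.
move=> h; apply/lee_addgt0Pr => e e0; have [k [p [hp pt <-]]] := h e e0.
by apply: (le_trans (rate_I1_lift hp)); rewrite -EFinD lee_fin.
Qed.

(* Data processing: the logarithm of the density is compared with that of its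
   conditional expectation given the first k digits through ln y <= y - 1. *)
Lemma relent_blaw_le (mu : probability R R) g k : is_density mu nu g ->
  mu.-integrable setT (fun x => (ln (g x))%:E) ->
  ((relent (@blaw R mu k) (@dlaw k))%:E <= \int[mu]_x (ln (g x))%:E)%E.
Proof.
move=> hg ig; have [mg g0 gE] := hg; have [p0 p1] := prob_vec_blaw mu k.
apply/lee_addgt0Pr => e e0.
(* The value [e] on null cylinders keeps [r] positive, and adds at most [e] to its integral under
   nu. *)
pose r (b : bitvec k) : R := if blaw mu b == 0 then e else blaw mu b / dlaw b.
have r0 b : 0 < r b.
  rewrite /r; case: eqP => // /eqP pb; rewrite divr_gt0 ?dlaw_gt0 //.
  by rewrite lt_def pb p0.
(* This is r/g wherever g is positive. In exponential form it stays positive where g vanishes, so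
   its logarithm splits everywhere. *)
pose h (u : R) : R := r (bits k u) * expR (- ln (g u)).
have mln : measurable_fun setT (fun u => ln (g u)).
  by apply: measurableT_comp => //; exact: measurable_ln.
have mh : measurable_fun setT h.
  apply: measurable_funM; first exact: (measurable_bits r).
  by apply: measurableT_comp => //; exact: measurable_funN.
have h0 u : 0 <= h u by rewrite mulr_ge0 ?expR_ge0 // ltW.
have mhE : measurable_fun setT (EFin \o h) by exact/measurable_EFinP.
have ih : (\int[mu]_u (h u)%:E <= (1 + e)%:E)%E.
  rewrite (integral_density hg mhE); last by move=> u; rewrite lee_fin.
  apply: (@le_trans _ _ (\int[nu]_u (r (bits k u))%:E)%E).
    apply: ge0_le_integral => //.
    - by move=> u _; rewrite mule_ge0 ?lee_fin.
    - by apply: emeasurable_funM => //; exact/measurable_EFinP.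
    - apply/measurable_EFinP; exact: (measurable_bits r).
    - move=> u _; rewrite -EFinM lee_fin /h -mulrA ler_piMr ?(ltW (r0 _)) //.
      have [gu|gu] := ltP 0 (g u); first by rewrite expRN lnK ?posrE // mulVf ?gt_eqF.
      by rewrite (le_anti (_ : g u <= 0 <= g u)) ?gu ?g0 ?mulr0.
  rewrite (integral_bits nu r) lee_fin -p1.
  have -> : e = \sum_(b : bitvec k) e * dlaw b by rewrite -mulr_sumr (prob_vec_dlaw R k).2 mulr1.
  rewrite -big_split /=; apply: ler_sum => b _; rewrite blaw_nu // /r.
  case: eqP => [->|_]; first by rewrite add0r mulrC.
  rewrite mulrC divfK ?gt_eqF ?dlaw_gt0 // lerDl mulr_ge0 // ?(ltW e0) //.
  exact/ltW/dlaw_gt0.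
have inth : mu.-integrable setT (EFin \o h).
  apply/integrableP; split => //.
  under eq_integral do rewrite /= ger0_norm //.
  exact: le_lt_trans ih (ltry _).
have intl := integrable_bits mu (fun b => ln (r b) + 1).
have intd : mu.-integrable setT (fun u => (ln (r (bits k u)) + 1)%:E - (ln (g u))%:E)%E.
  exact: integrableB.
have key : (\int[mu]_u ((ln (r (bits k u)) + 1)%:E - (ln (g u))%:E) <= \int[mu]_u (h u)%:E)%E.
  apply: le_integral => // u _; rewrite -EFinB lee_fin.
  have hp : 0 < h u by rewrite mulr_gt0 ?expR_gt0.
  have := ln_le_subr1 hp; rewrite /h lnM ?posrE ?expR_gt0 // expRK.
  by lra.
move: key; rewrite integralB // (integral_bits mu (fun b => ln (r b) + 1)).
have -> : \sum_b blaw mu b * (ln (r b) + 1) = relent (@blaw R mu k) (@dlaw k) + 1.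
  rewrite -[X in _ + X]p1 /relent -big_split /=; apply: eq_bigr => b _.
  by rewrite mulrDr mulr1 /r; case: eqP => [->|//]; rewrite !mul0r.
have /fineK <- := integrable_fin_num measurableT ig.
move=> /le_trans /(_ ih); rewrite -EFinB -EFinD !lee_fin.
lra.
Qed.

Lemma rate_I1_ge0 x : (0 <= rate_I1 nu x)%E.
Proof.
apply: le_ereal_inf_tmp => _ [mu _ <-]; apply: le_ereal_inf_tmp => _ [g [hg ig] <-].
apply: le_trans (relent_blaw_le 0 hg ig); rewrite lee_fin; apply: relent_ge0.
- exact: prob_vec_blaw.
- exact: prob_vec_dlaw.
- exact: dlaw_gt0.
Qed.

Lemma rate_I1_lt x t : (rate_I1 nu x < t%:E)%E -> 0 <= x <= 1 /\
  exists p : forall k, bitvec k -> R, [/\ forall k, prob_vec (p k),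
    forall k, relent (p k) (@dlaw k) < t & dform (p k) (p k) @[k --> \oo] --> x].
Proof.
move=> /ereal_inf_lt[_ [mu [_ Fx] <-]] /ereal_inf_lt[_ [g [hg ig] <-]] Ht.
split; first exact: fdig_integral_le1 Fx.
exists (@blaw R mu); split => k.
- exact: prob_vec_blaw.
- by rewrite -lte_fin; apply: le_lt_trans Ht; exact: relent_blaw_le.
- by have := @cvg_dform_blaw_fsec R mu; rewrite Fx => /fine_cvgP[_]; exact.
Qed.

Lemma rate_I1_approximable x t : (rate_I1 nu x <= t%:E)%E -> 0 <= x <= 1 /\ approximable x t.
Proof.
move=> h; have ht e : 0 < e -> (rate_I1 nu x < (t + e)%:E)%E.
  by move=> e0; apply: (le_lt_trans h); rewrite lte_fin ltrDl.
split; first by have [] := rate_I1_lt (ht 1 ltr01).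
move=> e N e0; have [_ [p [hp pt pF]]] := rate_I1_lt (ht e e0).
have /cvgrPdist_le/(_ e e0) := pF.
move=> [M _ hM]; exists (maxn M N), (p (maxn M N)); split => //.
- exact: leq_maxr.
- exact/ltW/pt.
- by rewrite distrC; apply: hM; exact: leq_maxl.
Qed.

(** Together with [rate_I1_approximable] this describes the sublevel sets by a condition stable
    under limits. Closedness and the compactness argument of the upper bound both rest on it. *)
Lemma approximable_rate_I1 x t : 0 <= x <= 1 -> approximable x t -> (rate_I1 nu x <= t%:E)%E.
Proof. by move=> x01 /(approximable_attainable x01) /attainable_rate_I1. Qed.

Lemma closed_rate_I1 t : closed [set x | I01 x /\ (rate_I1 nu x <= t%:E)%E].
Proof.
move=> x hx.
have ex e : 0 < e -> exists2 y, I01 y /\ (rate_I1 nu y <= t%:E)%E & `|x - y| < e.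
  by move=> e0; have [y [hy xy]] := hx (ball x e) (nbhsx_ballx x e e0); exists y.
have x01 : 0 <= x <= 1.
  apply/andP; split; rewrite leNgt; apply/negP => xl.
    have [y [/andP[y0 y1] _]] := ex (- x) ltac:(lra); rewrite ltr_norml => /andP[]; lra.
  have [y [/andP[y0 y1] _]] := ex (x - 1) ltac:(lra); rewrite ltr_norml => /andP[]; lra.
split => //; apply: approximable_rate_I1 => // e N e0.
have e20 : 0 < e / 2 by rewrite divr_gt0.
have [y [y01 yt] xy] := ex _ e20.
have [_ /(_ _ N e20)[k [p [Nk hp pt pF]]]] := rate_I1_approximable yt.
exists k, p; split => //; first lra.
rewrite -(subrK y (dform p p)) -addrA; apply: (le_trans (ler_normD _ _)).
by rewrite [`|y - x|]distrC; lra.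
Qed.

End DigitMeasure.

(** * Digits of a uniform integer *)

Section DigitDensity.
Variable R : realType.
Implicit Types (d k n : nat) (b : nat -> bool).

Definition agree k b m := [forall i : 'I_k, (nth_prime i %| m)%N == b i].

Definition density d k b n : R :=
  (\sum_(a < n) ((d %| a.+1)%N && agree k b a.+1)%:R) / n%:R.

Lemma count_multiples d n : (0 < d)%N -> (\sum_(a < n) (d %| a.+1) = n %/ d)%N.
Proof.
move=> d0; elim: n => [|n ih]; first by rewrite big_ord0 div0n.
by rewrite big_ord_recr /= ih divnS // addnC.
Qed.

Lemma sum_multiples d n : (0 < d)%N ->
  \sum_(a < n) (d %| a.+1)%N%:R = (n %/ d)%N%:R :> R.
Proof. by move=> d0; rewrite -count_multiples // natr_sum. Qed.

Lemma agreeS k b m : agree k.+1 b m = agree k b m && ((nth_prime k %| m)%N == b k).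
Proof.
apply/forallP/andP => [h|[/forallP h hk] i].
  by split; [apply/forallP => i; exact: (h (widen_ord (leqnSn k) i)) | exact: (h ord_max)].
by have := ltn_ord i; rewrite ltnS leq_eqVlt => /predU1P[->//|ik]; exact: (h (Ordinal ik)).
Qed.

(** The divisor [d] carries the induction on [k]: divisibility by the next prime is absorbed into
    [d], and non-divisibility is the difference of the densities for [d] and for [d] times that
    prime. *)
Lemma cvg_density d k b : (0 < d)%N ->
  (forall i, (i < k)%N -> coprime d (nth_prime i)) ->
  density d k b n @[n --> \oo] --> d%:R^-1 * \prod_(i < k) bern R i (b i).
Proof.
elim: k d => [|k ih] d d0 hd.
  rewrite big_ord0 mulr1.
  apply: (@squeeze_cvgr _ _ _ _ (fun n => d%:R^-1 - n%:R^-1) (fun=> d%:R^-1)).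
  - near=> n; have n0 : (0 < n)%N by near: n; exact: nbhs_infty_gt.
    rewrite /density (eq_bigr (fun a : 'I_n => (d %| a.+1)%N%:R)); last first.
      move=> a _; rewrite (_ : agree 0 b a.+1) ?andbT //.
      by apply/forallP => -[].
    rewrite sum_multiples //; apply/andP; split.
      rewrite ler_pdivlMr ?ltr0n // mulrBl mulVf ?pnatr_eq0 -?lt0n //.
      rewrite lerBlDr -ler_pdivlMl ?invr_gt0 ?ltr0n // invrK natr1 -natrM ler_nat.
      by rewrite {1}(divn_eq n d) mulnS addnC mulnC leq_add2r ltnW // ltn_pmod.
    rewrite ler_pdivrMr ?ltr0n // ler_pdivlMl ?ltr0n // -natrM ler_nat mulnC.
    exact: leq_trunc_div.
  - rewrite -[X in _ --> X]subr0; apply: cvgB; first exact: cvg_cst.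
    apply/gtr0_cvgV0; last exact: cvgr_idn.
    by near=> n; rewrite ltr0n; near: n; exact: nbhs_infty_gt.
  - exact: cvg_cst.
have hk i : (i < k)%N -> coprime d (nth_prime i) by move=> ik; apply: hd; exact: ltnW.
have pk0 : (0 < nth_prime k)%N by rewrite prime_gt0 ?prime_nth_prime.
have h1 := ih d d0 hk.
have h2 : density (d * nth_prime k) k b n @[n --> \oo] -->
    (d * nth_prime k)%:R^-1 * \prod_(i < k) bern R i (b i).
  apply: ih; first by rewrite muln_gt0 d0.
  move=> i ik; rewrite coprimeMl hk //= prime_coprime ?prime_nth_prime //.
  rewrite dvdn_prime2 ?prime_nth_prime //; apply/eqP => /nth_prime_inj e.
  by rewrite e ltnn in ik.
have dv m : ((d * nth_prime k) %| m)%N = (d %| m)%N && (nth_prime k %| m)%N.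
  by rewrite Gauss_dvd // hd.
rewrite big_ord_recr /=; case bk : (b k).
  rewrite /bern /pr; have -> : d%:R^-1 * (\prod_(i < k) bern R i (b i) * (nth_prime k)%:R^-1) =
    (d * nth_prime k)%:R^-1 * \prod_(i < k) bern R i (b i) :> R by rewrite natrM invfM; ring.
  apply: cvg_trans h2; apply: near_eq_cvg; near=> n.
  congr (_ / _); apply: eq_bigr => a _; congr (nat_of_bool _)%:R.
  by rewrite agreeS bk eqb_id dv; case: (d %| _)%N; rewrite //= andbC.
have -> : d%:R^-1 * (\prod_(i < k) bern R i (b i) * bern R k false) =
    d%:R^-1 * \prod_(i < k) bern R i (b i) -
    (d * nth_prime k)%:R^-1 * \prod_(i < k) bern R i (b i).
  by rewrite /bern /pr natrM invfM; ring.
apply: cvg_trans (cvgB h1 h2); apply: near_eq_cvg; near=> n.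
change (density d k b n - density (d * nth_prime k) k b n = density d k.+1 b n).
rewrite /density -mulrBl -sumrB; congr (_ / _); apply: eq_bigr => a _.
rewrite agreeS bk dv eqbF_neg.
by case: (d %| _)%N; case: (agree _ _ _); case: (nth_prime k %| _)%N; rewrite /= ?subrr ?subr0.
Unshelve. all: by end_near. Qed.

Definition dcode k (m : nat) : bitvec k := [ffun i : 'I_k => (nth_prime i %| m)%N].

Definition dfreq k n (b : bitvec k) : R :=
  (\sum_(a < n) (dcode k a.+1 == b)%:R) / n%:R.

Lemma cvg_dfreq k (b : bitvec k) : dfreq n b @[n --> \oo] --> dlaw R b.
Proof.
pose b' i := if insub i is Some j then b j else false.
have bE (i : 'I_k) : b' i = b i by rewrite /b' valK.
have -> : dlaw R b = 1%:R^-1 * \prod_(i < k) bern R i (b' i).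
  by rewrite invr1 mul1r; apply: eq_bigr => i _; rewrite bE.
apply: cvg_trans (@cvg_density 1 k b' isT (fun i _ => coprime1n _)).
 apply: near_eq_cvg; near=> n; congr (_ / _); apply: eq_bigr => a _.
congr (nat_of_bool _)%:R; rewrite dvd1n /=; apply/forallP/eqP => [h|h i].
  by apply/ffunP => i; rewrite ffunE (eqP (h i)) bE.
by rewrite bE -h ffunE.
Unshelve. all: by end_near. Qed.

End DigitDensity.

(** * Sums over product spaces *)

Section ProductSums.
Variable R : realType.

Lemma sum_ffun_comp (I A T : finType) (c : A -> T) (Phi : {ffun I -> T} -> R) :
  \sum_(x : {ffun I -> A}) Phi [ffun i => c (x i)] =
  \sum_(y : {ffun I -> T}) Phi y * \prod_i \sum_a (c a == y i)%:R.
Proof.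
transitivity (\sum_(x : {ffun I -> A}) \sum_(y : {ffun I -> T})
    Phi y * \prod_i (c (x i) == y i)%:R).
  apply: eq_bigr => x _; rewrite (bigD1 [ffun i => c (x i)]) //= big1 ?mulr1; last first.
    by move=> i _; rewrite ffunE eqxx.
  rewrite big1 ?addr0 // => y yx; rewrite prod_nat_of_forall.
  case: forallP => [h|]; last by rewrite mulr0.
  by case/eqP: yx; apply/ffunP => i; rewrite ffunE (eqP (h i)).
rewrite exchange_big; apply: eq_bigr => y _; rewrite -mulr_sumr; congr (_ * _).
by rewrite bigA_distr_bigA.
Qed.

(* Pairs {i, s i} are disjoint, so the factors are independent after expanding
   each of them over d. *)
Lemma sum_prod_involution (I A D : finType) (s : I -> I) (M : {set I})
    (h : A -> A -> R) (phi : D -> A -> R) (w : D -> R) (rho : R) (d0 : D) :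
  involutive s -> (forall i, i \in M -> s i \notin M) ->
  (forall a b, 0 <= h a b <= \sum_d phi d a * phi d b) ->
  (forall d a, 0 <= phi d a) ->
  (forall d, \sum_a phi d a <= #|A|%:R * w d) -> (forall d, 0 <= w d) ->
  \sum_d w d ^+ 2 <= rho ->
  \sum_(x : {ffun I -> A}) \prod_(i in M) h (x i) (x (s i)) <=
  #|A|%:R ^+ #|I| * rho ^+ #|M|.
Proof.
move=> sK sM hphi phi0 phiw w0 wr.
(* Indices outside [M] get a dummy summation pinned at [d0], so that the product over all of [I]
   distributes over functions from [I] to [D]. *)
pose F (x : {ffun I -> A}) i d : R :=
  if i \in M then phi d (x i) * phi d (x (s i)) else (d == d0)%:R.
apply: (@le_trans _ _ (\sum_(x : {ffun I -> A}) \sum_(e : {ffun I -> D}) \prod_i F x i (e i))).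
  apply: ler_sum => x _; rewrite -bigA_distr_bigA big_mkcond; apply: ler_prod => i _.
  rewrite /F; case: (i \in M) => //; rewrite ler01 (bigD1 d0) //= eqxx lerDl.
  by apply: sumr_ge0 => d _; rewrite ler0n.
rewrite exchange_big /=.
have -> : #|A|%:R ^+ #|I| * rho ^+ #|M| = #|A|%:R ^+ #|I| * \prod_(i : I) (if i \in M then rho else 1).
  by rewrite -big_mkcond prodr_const.
apply: (@le_trans _ _ (#|A|%:R ^+ #|I| * \sum_(e : {ffun I -> D})
    \prod_i (if i \in M then w (e i) ^+ 2 else (e i == d0)%:R))); last first.
  rewrite ler_wpM2l ?exprn_ge0 //.
  rewrite -(bigA_distr_bigA (fun i d => if i \in M then w d ^+ 2 else (d == d0)%:R)).
  apply: ler_prod => i _; case: (i \in M); first by rewrite wr sumr_ge0 // => d _; rewrite sqr_ge0.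
  by rewrite (bigD1 d0) //= eqxx big1 ?addr0 ?ler01 ?lexx // => d /negbTE ->.
rewrite mulr_sumr; apply: ler_sum => e _.
(* Reindexing by [s] collects the factors by coordinate: coordinate i meets [phi (e i)] if i is in
   [M] and [phi (e (s i))] if s i is, but never both. *)
have -> : \sum_(x : {ffun I -> A}) \prod_i F x i (e i) =
    \prod_i (if i \in M then 1 else (e i == d0)%:R) *
    \prod_i \sum_a (if i \in M then phi (e i) a else 1) * (if s i \in M then phi (e (s i)) a else 1).
  rewrite bigA_distr_bigA mulr_sumr; apply: eq_bigr => x _.
  rewrite big_split /= [X in _ = _ * (_ * X)](reindex_inj (inv_inj sK)) /= -!big_split /=.
  apply: eq_bigr => i _; rewrite sK /F; case: (i \in M); rewrite ?mul1r ?mulr1 //.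
have -> : \prod_i (if i \in M then w (e i) ^+ 2 else (e i == d0)%:R) =
    \prod_i (if i \in M then 1 else (e i == d0)%:R) *
    \prod_i ((if i \in M then w (e i) else 1) * (if s i \in M then w (e (s i)) else 1)).
  rewrite big_split /= [X in _ = _ * (_ * X)](reindex_inj (inv_inj sK)) /= -!big_split /=.
  by apply: eq_bigr => i _; rewrite sK; case: (i \in M); rewrite ?mul1r ?mulr1 ?expr2.
rewrite mulrCA ler_wpM2l //; first by apply: prodr_ge0 => i _; case: ifP.
rewrite -prodr_const -big_split /=; apply: ler_prod => i _; apply/andP; split.
  by apply: sumr_ge0 => a _; rewrite mulr_ge0 //; case: ifP.
case: (boolP (i \in M)) => iM; first by rewrite (negbTE (sM i iM)) mulr1; under eq_bigr do rewrite mulr1.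
case: ifP => _; first by rewrite mul1r; under eq_bigr do rewrite mul1r.
by rewrite !mulr1 sumr_const.
Qed.

End ProductSums.

(** * Pairs with a common divisor greater than k *)

Section BadPairs.
Variables (R : realType) (k n0 : nat).
Local Notation n := n0.+1.

Definition share (a b : 'I_n) : bool :=
  [exists d : 'I_n.+1, [&& (k < d)%N, (d %| a.+1)%N & (d %| b.+1)%N]].

Lemma shareC a b : share a b = share b a.
Proof. by apply: eq_existsb => d; rewrite [X in _ && X]andbC. Qed.

Definition nshare (x : {ffun 'I_n -> 'I_n}) : R := \sum_i \sum_j (share (x i) (x j))%:R.

Lemma sum_inv_sqr m : (0 < k)%N -> \sum_(d < m.+1 | (k < d)%N) (d%:R^-1 ^+ 2 : R) <= k%:R^-1.
Proof.
move=> k0.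
(* Telescoping of 1/d^2 <= 1/(d - 1) - 1/d; [maxn] covers the empty range m <= k. *)
suff h : \sum_(d < m.+1 | (k < d)%N) (d%:R^-1 ^+ 2 : R) <= k%:R^-1 - (maxn k m)%:R^-1.
  by apply: (le_trans h); rewrite lerBlDr lerDl invr_ge0.
rewrite big_mkcond; elim: m => [|m ih].
  by rewrite big_ord_recl big_ord0 /= maxn0 subrr addr0.
rewrite big_ord_recr /=; case: ifP => [|/negbT].
  rewrite ltnS => km; move: ih; rewrite !(maxn_idPr _) //; last exact: leqW.
  have m0 : (0 : R) < m%:R by rewrite ltr0n (leq_trans k0).
  have : (m.+1%:R^-1 ^+ 2 : R) <= m%:R^-1 - m.+1%:R^-1.
    have -> : m%:R^-1 - m.+1%:R^-1 = (m%:R * m.+1%:R)^-1 :> R.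
      by rewrite -natr1; field; lra.
    rewrite exprVn lef_pV2 ?posrE ?exprn_gt0 ?mulr_gt0 ?ltr0Sn // expr2 ler_pM2r ?ltr0Sn //.
    by rewrite ler_nat.
  set u := m.+1%:R^-1; set v := m%:R^-1; lra.
rewrite -leqNgt => mk; rewrite addr0; move: ih; rewrite !(maxn_idPl _) //.
exact: leq_trans mk.
Qed.

(** A given d divides both entries of a pair with probability at most 1/d^2, and summing over d > k
    gives 1/k. The condition i < t - i selects one index per pair and excludes fixed points. *)
Lemma sum_share_involution (t : 'I_n) (M : {set 'I_n}) : (0 < k)%N ->
  (forall i, i \in M -> (i < (t - i)%R)%N) ->
  \sum_(x : {ffun 'I_n -> 'I_n}) \prod_(i in M) (share (x i) (x (t - i)))%:R <=
  n%:R ^+ n * (k%:R^-1 : R) ^+ #|M|.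
Proof.
move=> k0 hM.
have tKr (i : 'I_n) : t - (t - i) = i by rewrite opprB addrC subrK.
  have tK : involutive (fun i : 'I_n => t - i) by exact: tKr.
pose phi (d : 'I_n.+1) (a : 'I_n) : R := ((k < d)%N && (d %| a.+1)%N)%:R.
pose w (d : 'I_n.+1) : R := if (k < d)%N then d%:R^-1 else 0.
have := @sum_prod_involution R 'I_n 'I_n 'I_n.+1 (fun i => t - i) M
  (fun a b => (share a b)%:R) phi w k%:R^-1 ord0 tK.
rewrite card_ord; apply.
- move=> i iM; apply/negP => /hM; rewrite tKr => h.
  by have := ltn_trans h (hM i iM); rewrite ltnn.
- move=> a b; rewrite ler0n /=; case: (boolP (share a b)) => [/existsP[d /and3P[kd da db]]|_].
    rewrite (bigD1 d) //= /phi kd da db /= mulr1 lerDl.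
    by apply: sumr_ge0 => e _; rewrite mulr_ge0.
  by apply: sumr_ge0 => e _; rewrite mulr_ge0.
- by move=> d a; rewrite ler0n.
- move=> d; rewrite /phi /w; case: ifP => kd /=; last first.
    by rewrite mulr0 sumr_le0.
  have d0 : (0 < d)%N by exact: leq_ltn_trans kd.
  rewrite sum_multiples // ler_pdivlMr ?ltr0n // -natrM ler_nat.
  exact: leq_trunc_div.
- by move=> d; rewrite /w; case: ifP => // _; rewrite invr_ge0.
- apply: le_trans (sum_inv_sqr n k0); rewrite [leRHS]big_mkcond.
  by apply: ler_sum => d _; rewrite /w; case: ifP => //; rewrite expr0n.
Qed.

(** Pigeonhole over the [n] classes t = i + j in Z/n: the diagonal accounts for at most [n] pairs,
    so some class holds more than c n - 1 sharing ordered pairs, and half of them satisfy i < t -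
    i. *)
Lemma nshare_exists (c : R) (x : {ffun 'I_n -> 'I_n}) : c * n%:R ^+ 2 < nshare x ->
  exists t : 'I_n, (c * n%:R - 1) / 2 <
    #|[set i : 'I_n | (i < (t - i)%R)%N && share (x i) (x (t - i))]%SET|%:R.
Proof.
move=> cx; apply: contrapT => /forallNP H.
have {}H t : \sum_(i : 'I_n) ((i != t - i) && share (x i) (x (t - i)))%:R <= c * n%:R - 1.
  have /negP := H t; rewrite -leNgt => ht.
  have tKr (i : 'I_n) : t - (t - i) = i by rewrite opprB addrC subrK.
  have tK : involutive (fun i : 'I_n => t - i) by exact: tKr.
  pose f (i : 'I_n) : R := ((i < (t - i)%R)%N && share (x i) (x (t - i)))%:R.
  have -> : \sum_(i : 'I_n) ((i != t - i) && share (x i) (x (t - i)))%:R = \sum_i f i + \sum_i f i.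
    rewrite [X in _ = _ + X](reindex_inj (inv_inj tK)) /= -big_split; apply: eq_bigr => i _.
    rewrite /f tKr [share (x (t - i)) _]shareC -[i == _]val_eqE neq_ltn.
    by case: (share _ _); rewrite ?andbF ?andbT /= ?addr0 //; case: ltngtP; rewrite ?addr0 ?add0r.
  have -> : \sum_i f i = #|[set i : 'I_n | (i < (t - i)%R)%N && share (x i) (x (t - i))]%SET|%:R.
    by rewrite -sum1_card natr_sum [RHS]big_mkcond; apply: eq_bigr => i _; rewrite inE /f; case: ifP.
  by lra.
have : nshare x <= n%:R + \sum_i \sum_j ((i != j) && share (x i) (x j))%:R.
  rewrite -[X in X%:R + _](card_ord n) -sum1_card natr_sum -big_split /=; apply: ler_sum => i _.
  rewrite (bigD1 i) //= [X in _ <= _ + X](bigD1 i) //= eqxx /= add0r; apply: lerD.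
    by rewrite ler_nat; case: share.
  by apply: ler_sum => j ji; rewrite eq_sym ji.
have -> : \sum_i \sum_j ((i != j) && share (x i) (x j))%:R =
    \sum_t \sum_i ((i != t - i) && share (x i) (x (t - i)))%:R :> R.
  rewrite [RHS]exchange_big /=; apply: eq_bigr => i _.
  rewrite (reindex_inj (inj_comp (addrI (- i)) (@inj_id _))) /=.
  by apply: eq_bigr => t _; rewrite addrC.
have : \sum_t \sum_i ((i != t - i) && share (x i) (x (t - i)))%:R <= n%:R * (c * n%:R - 1) :> R.
  apply: (@le_trans _ _ (\sum_(t < n) (c * n%:R - 1))); first exact: ler_sum.
  by rewrite sumr_const card_ord -[leLHS]mulr_natl.
move: cx; rewrite expr2; nra.
Qed.

(** Union bound over the class [t] (n choices) and the exact set [M] of sharing indices (at most 2^n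
    choices). *)
Lemma nshare_tail (c : R) : (0 < k)%N ->
  \sum_(x : {ffun 'I_n -> 'I_n}) (c * n%:R ^+ 2 < nshare x)%R%:R <=
  n%:R ^+ n * (n%:R * 2 ^+ n * expR (- ((c * n%:R - 1) / 2 * ln k%:R))) :> R.
Proof.
move=> k0; set E := expR _.
pose P (t : 'I_n) (M : {set 'I_n}) := (M \subset [set i : 'I_n | (i < (t - i)%R)%N]%SET) && ((c * n%:R - 1) / 2 < #|M|%:R).
apply: (@le_trans _ _ (\sum_(x : {ffun 'I_n -> 'I_n}) \sum_(t : 'I_n) \sum_(M : {set 'I_n} | P t M)
    \prod_(i in M) (share (x i) (x (t - i)))%:R)).
  apply: ler_sum => x _.
  have nn (t : 'I_n) (M : {set 'I_n}) : 0 <= \prod_(i in M) (share (x i) (x (t - i)))%:R :> R by apply: prodr_ge0.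
  case: (boolP (_ < _)) => [/nshare_exists[t ht]|_]; last first.
    by apply: sumr_ge0 => t _; apply: sumr_ge0.
  set M := [set i | _]%SET in ht.
  rewrite (bigD1 t) //= (bigD1 M) /=; last first.
    by rewrite /P ht andbT; apply/fintype.subsetP => i; rewrite !inE => /andP[].
  rewrite big1 => [|i]; last by rewrite inE => /andP[_ ->].
  by rewrite -addrA lerDl addr_ge0 //; repeat (apply: sumr_ge0 => ? _).
rewrite exchange_big /=.
have kR : 1 <= k%:R :> R by rewrite ler1n.
apply: (@le_trans _ _ (\sum_(t : 'I_n) \sum_(M : {set 'I_n}) n%:R ^+ n * E)); last first.
  rewrite !sumr_const -[#|{set _}|]cardsT -powersetT card_powerset cardsT !card_ord -mulrnA -[leLHS]mulr_natl natrM natrX.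
  by rewrite le_eqVlt; apply/orP; left; apply/eqP; ring.
apply: ler_sum => t _; rewrite exchange_big /= big_mkcond; apply: ler_sum => M _.
have E0 : 0 <= E by exact: expR_ge0.
case: ifP => [/andP[/fintype.subsetP MH hM]|_]; last by rewrite mulr_ge0 ?exprn_ge0.
apply: (le_trans (sum_share_involution k0 _)).
  by move=> i /MH; rewrite inE.
rewrite ler_wpM2l ?exprn_ge0 // /E.
have -> : k%:R^-1 ^+ #|M| = expR (- (#|M|%:R * ln k%:R)) :> R.
  by rewrite expRN expRM_natl lnK ?posrE ?ltr0n // exprVn.
rewrite ler_expR lerN2 ler_wpM2r ?ln_ge0 //; exact: ltW.
Qed.

End BadPairs.

(** * Sanov's theorem *)

Section Sanov.
Variables (R : realType) (T : finType) (n : nat).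
Hypothesis n0 : (0 < n)%N.
Implicit Types (y : {ffun 'I_n -> T}) (p r : T -> R).

Let nR : 0 < n%:R :> R. Proof. by rewrite ltr0n. Qed.

Definition hits y b : nat := \sum_(i < n) (y i == b).

Definition emp y b : R := (hits y b)%:R / n%:R.

Lemma empE y b : n%:R * emp y b = (hits y b)%:R.
Proof. by rewrite /emp mulrC divfK // gt_eqF. Qed.

Lemma sum_emp y (phi : T -> R) : n%:R * \sum_b emp y b * phi b = \sum_i phi (y i).
Proof.
rewrite mulr_sumr; under eq_bigr do rewrite mulrA empE /hits natr_sum mulr_suml.
rewrite exchange_big; apply: eq_bigr => i _ /=.
rewrite (bigD1 (y i)) //= eqxx mul1r big1 ?addr0 // => b.
by rewrite eq_sym => /negbTE ->; rewrite mul0r.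
Qed.

Lemma prob_vec_emp y : prob_vec (emp y).
Proof.
split=> [b|]; first by rewrite divr_ge0.
have := sum_emp y (fun=> 1); under eq_bigr do rewrite mulr1.
rewrite sumr_const card_ord => h; apply: (mulfI (lt0r_neq0 nR)).
by rewrite mulr1.
Qed.

Lemma emp_gt0 y i : 0 < emp y (y i).
Proof. by rewrite divr_gt0 // ltr0n /hits (bigD1 i) //= eqxx. Qed.

Lemma hits_le y b : (hits y b < n.+1)%N.
Proof.
rewrite ltnS -[X in (_ <= X)%N](card_ord n) -sum1_card.
by apply: leq_sum => i _; case: (_ == _).
Qed.

Lemma sum_prod_ffun (q : 'I_n -> T -> R) :
  \sum_(y : {ffun 'I_n -> T}) \prod_i q i (y i) = \prod_i \sum_b q i b.
Proof. by rewrite bigA_distr_bigA. Qed.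

Lemma prod_emp r y : (forall b, 0 < r b) ->
  \prod_i r (y i) = expR (- (n%:R * relent (emp y) r)) * \prod_i emp y (y i).
Proof.
move=> r0; rewrite /relent sum_emp -sumrN expR_sum -big_split /=.
apply: eq_bigr => i _; have e0 := emp_gt0 y i.
have q0 : 0 < emp y (y i) / r (y i) by exact: divr_gt0.
by rewrite expRN lnK ?posrE // invf_div divfK // gt_eqF.
Qed.

(** There are at most (n + 1)^|T| types, and each type class has probability at most 1 under its own
    empirical law. *)
Lemma sum_prod_emp : \sum_y \prod_i emp y (y i) <= n.+1%:R ^+ #|T|.
Proof.
pose typ y : {ffun T -> 'I_n.+1} := [ffun b => Ordinal (hits_le y b)].
rewrite (partition_big typ xpredT) //=.
rewrite -natrX -[X in (X ^ _)%N]card_ord -card_ffun -sum1_card natr_sum.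
apply: ler_sum => c _.
have [y /eqP yc|H] := pickP (fun y => typ y == c); last by rewrite big_pred0.
apply: (@le_trans _ _ (\sum_(y' : {ffun 'I_n -> T}) \prod_i emp y (y' i))); last first.
  rewrite (sum_prod_ffun (fun=> emp y)).
  by rewrite big1 // => i _; rewrite (prob_vec_emp y).2.
rewrite big_mkcond; apply: ler_sum => y' _; case: ifP => [/eqP y'c|_].
  rewrite le_eqVlt; apply/orP; left; apply/eqP; apply: eq_bigr => i _.
  rewrite /emp; congr (_%:R / _).
  have := congr1 (fun f : {ffun T -> 'I_n.+1} => f (y' i)) (etrans y'c (esym yc)).
  by rewrite !ffunE => /(congr1 val).
by apply: prodr_ge0 => i _; rewrite divr_ge0.
Qed.

Lemma sanov_upper r h (G : pred {ffun 'I_n -> T}) : (forall b, 0 < r b) ->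
  (forall y, G y -> h <= relent (emp y) r) ->
  \sum_(y | G y) \prod_i r (y i) <= n.+1%:R ^+ #|T| * expR (- (n%:R * h)).
Proof.
move=> r0 hG; apply: (@le_trans _ _ (\sum_y expR (- (n%:R * h)) * \prod_i emp y (y i))).
  rewrite big_mkcond; apply: ler_sum => y _.
  have e0 : 0 <= \prod_i emp y (y i) by apply: prodr_ge0 => i _; exact/ltW/emp_gt0.
  case: ifP => [Gy|_]; last by rewrite mulr_ge0 ?expR_ge0.
  rewrite prod_emp // ler_wpM2r // ler_expR lerN2 ler_pM2l //; exact: hG.
by rewrite -mulr_sumr mulrC ler_wpM2r ?expR_ge0 // sum_prod_emp.
Qed.

Lemma second_moment p b : prob_vec p ->
  \sum_(y : {ffun 'I_n -> T}) (\prod_i p (y i)) * ((hits y b)%:R - n%:R * p b) ^+ 2 <= n%:R.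
Proof.
move=> [p0 p1]; pose phi a : R := (a == b)%:R - p b.
have pb1 : p b <= 1 by rewrite -p1 (bigD1 b) //= lerDl; apply: sumr_ge0.
have phi_mean : \sum_a p a * phi a = 0.
  under eq_bigr do rewrite mulrBr; rewrite sumrB -mulr_suml p1 mul1r.
  rewrite (bigD1 b) //= eqxx mulr1 big1 ?addr0 ?subrr // => a /negbTE ->.
  by rewrite mulr0.
have phi_sqr : \sum_a p a * phi a ^+ 2 <= 1.
  rewrite -p1; apply: ler_sum => a _; rewrite ler_piMr // /phi.
  by have := p0 b; case: (a == b); rewrite /= ?sub0r; nra.
have e y : (hits y b)%:R - n%:R * p b = \sum_i phi (y i).
  by rewrite /phi sumrB sumr_const card_ord mulr_natl /hits natr_sum.
have cov i j : \sum_(y : {ffun 'I_n -> T}) (\prod_l p (y l)) * (phi (y i) * phi (y j)) =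
    if i == j then \sum_a p a * phi a ^+ 2 else 0.
  pose G l a : R := (if l == i then phi a else 1) * (if l == j then phi a else 1).
  transitivity (\prod_l \sum_a p a * G l a).
    rewrite -sum_prod_ffun; apply: eq_bigr => y _.
    rewrite !big_split /= -!big_mkcond /= !(big_pred1_eq _ _ (fun l => phi (y l))) //.
  rewrite (bigD1 i) //=; case: (eqVneq i j) => [ij|ij].
    rewrite /G -ij eqxx [X in _ * X]big1 ?mulr1; last first.
      by move=> l /negbTE li; rewrite li -[RHS]p1; apply: eq_bigr => a _; rewrite !mulr1.
    by apply: eq_bigr => a _; rewrite expr2.
  rewrite (_ : \sum_a p a * G i a = 0) ?mul0r // -[RHS]phi_mean.
  by apply: eq_bigr => a _; rewrite /G eqxx (negbTE ij) mulr1.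
have -> : \sum_(y : {ffun 'I_n -> T}) (\prod_i p (y i)) * ((hits y b)%:R - n%:R * p b) ^+ 2 =
    \sum_i \sum_j \sum_(y : {ffun 'I_n -> T}) (\prod_l p (y l)) * (phi (y i) * phi (y j)).
  under [RHS]eq_bigr do rewrite exchange_big /=.
  rewrite [RHS]exchange_big /=; apply: eq_bigr => y _; rewrite e expr2 big_distrl /= mulr_sumr.
  by apply: eq_bigr => i _; rewrite !mulr_sumr.
rewrite -[X in _ <= X%:R](card_ord n) -sum1_card natr_sum; apply: ler_sum => i _.
rewrite (bigD1 i) //= cov eqxx [X in _ + X]big1 ?addr0 // => j ji.
by rewrite cov eq_sym (negbTE ji).
Qed.

Definition near_emp p (d : R) y := [forall b, `|emp y b - p b| <= d].

(** Chebyshev's inequality for each symbol, then a union bound over [T]. *)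
Lemma prob_not_near_emp p d : prob_vec p -> 0 < d ->
  \sum_(y | ~~ near_emp p d y) \prod_i p (y i) <= #|T|%:R / (n%:R * d ^+ 2).
Proof.
move=> hp d0; have [p0 p1] := hp.
have nd : 0 < n%:R * d by rewrite mulr_gt0.
have pp y : 0 <= \prod_i p (y i) by apply: prodr_ge0.
apply: (@le_trans _ _ (\sum_b \sum_(y : {ffun 'I_n -> T}) (\prod_i p (y i)) *
    ((hits y b)%:R - n%:R * p b) ^+ 2 / (n%:R * d) ^+ 2)).
  rewrite exchange_big big_mkcond; apply: ler_sum => y _ /=.
  have nn b : 0 <= (\prod_i p (y i)) * ((hits y b)%:R - n%:R * p b) ^+ 2 / (n%:R * d) ^+ 2.
    by rewrite divr_ge0 ?sqr_ge0 // mulr_ge0 ?sqr_ge0.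
  case: ifP => [/forallPn[b hb]|_]; last exact: sumr_ge0.
  rewrite (bigD1 b) //= ler_wpDr //; first exact: sumr_ge0.
  rewrite -mulrA ler_peMr // ler_pdivlMr ?exprn_gt0 // mul1r -[leRHS]real_normK ?num_real //.
  rewrite lerXn2r ?nnegrE ?(ltW nd) //.
  rewrite -empE -mulrBr normrM gtr0_norm // ler_pM2l // ltW // ltNge //.
have -> : #|T|%:R / (n%:R * d ^+ 2) = \sum_(b : T) (n%:R * d ^+ 2)^-1.
  by rewrite sumr_const mulr_natl.
apply: ler_sum => b _; rewrite -mulr_suml ler_pdivrMr ?exprn_gt0 //.
apply: (le_trans (second_moment b hp)); rewrite le_eqVlt; apply/orP; left; apply/eqP.
by field; rewrite !gt_eqF.
Qed.

(** Change of measure from [r] to [p]: near [p] the mean log likelihood ratio differs from the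
    entropy by at most [d] times the sum of the absolute logarithms, and half of the [p]-mass is
    near [p]. *)
Lemma sanov_lower p r d : prob_vec p -> (forall b, 0 < r b) -> 0 < d ->
  2 * #|T|%:R <= n%:R * d ^+ 2 ->
  2^-1 * expR (- (n%:R * (relent p r + d * \sum_b `|ln (p b / r b)|))) <=
  \sum_(y | near_emp p d y) \prod_i r (y i).
Proof.
move=> hp r0 d0 hn; have [p0 p1] := hp; set E := expR _.
have nd : 0 < n%:R * d ^+ 2 by rewrite mulr_gt0 // exprn_gt0.
have half : 2^-1 <= \sum_(y | near_emp p d y) \prod_i p (y i).
  have tot : \sum_(y : {ffun 'I_n -> T}) \prod_i p (y i) = 1.
    by rewrite (sum_prod_ffun (fun=> p)) big1.
  have := prob_not_near_emp hp d0.
  have : #|T|%:R / (n%:R * d ^+ 2) <= 2^-1 :> R by rewrite ler_pdivrMr //; lra.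
  by move: tot; rewrite (bigID (near_emp p d)) /=; lra.
apply: (@le_trans _ _ ((\sum_(y | near_emp p d y) \prod_i p (y i)) * E)).
  by rewrite ler_wpM2r ?expR_ge0.
rewrite mulr_suml; apply: ler_sum => y /forallP ny.
(* A word using a symbol of [p]-mass 0 contributes 0 on the left; for the others all likelihood
   ratios are positive. *)
have [/existsP[i /eqP pi]|/existsPn pn] := boolP [exists i, p (y i) == 0].
  rewrite (bigD1 i) //= pi !mul0r; apply: prodr_ge0 => j _; exact/ltW/r0.
have py i : 0 < p (y i) by rewrite lt_def pn p0.
have -> : \prod_i r (y i) = (\prod_i p (y i)) * expR (- \sum_i ln (p (y i) / r (y i))).
  rewrite -sumrN expR_sum -big_split /=; apply: eq_bigr => i _.
  rewrite -lnV ?posrE ?divr_gt0 // lnK ?posrE ?invr_gt0 ?divr_gt0 //.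
  by rewrite invf_div mulrC divfK // gt_eqF.
have pp : 0 <= \prod_i p (y i) by apply: prodr_ge0.
rewrite ler_wpM2l // ler_expR lerN2 -(sum_emp y (fun b => ln (p b / r b))) ler_pM2l // /relent.
rewrite mulr_sumr -big_split; apply: ler_sum => b _ /=.
rewrite -lerBlDl -mulrBl; apply: (le_trans (ler_norm _)).
by rewrite normrM ler_wpM2r.
Qed.

End Sanov.

(** * Bounds on the law of the statistic *)

Section Statistic.
Variables (R : realType) (k n0 : nat).
Local Notation n := n0.+1.
Implicit Types x : {ffun 'I_n -> 'I_n}.

Definition xcode x : {ffun 'I_n -> bitvec k} := [ffun i => dcode k (x i).+1].

Lemma dform_emp (y : {ffun 'I_n -> bitvec k}) :
  dform (emp R y) (emp R y) = (\sum_i \sum_j (disj (y i) (y j))%:R) / n%:R ^+ 2.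
Proof.
have nn : n%:R != 0 :> R by rewrite pnatr_eq0.
apply: (canRL (mulfK _)); first by rewrite expf_neq0.
rewrite /dform /form.
under eq_bigr do under eq_bigr do rewrite -mulrA.
under eq_bigr do rewrite -mulr_sumr.
rewrite expr2 mulrC -mulrA sum_emp // mulr_sumr; apply: eq_bigr => i _.
by rewrite sum_emp.
Qed.

Lemma coprime_stat_I01 x : I01 (coprime_stat R x).
Proof.
have n2 : 0 < n%:R ^+ 2 :> R by rewrite exprn_gt0.
rewrite /I01 /= /coprime_stat divr_ge0 ?(ltW n2) //=; last by do 2!apply: sumr_ge0 => ? _.
rewrite ler_pdivrMr // mul1r.
apply: (@le_trans _ _ (\sum_(i < n) \sum_(j < n) 1)).
  by do 2!apply: ler_sum => ? _; case: coprime; rewrite /= ?ler01 ?lexx.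
by rewrite !sumr_const !card_ord -mulrnA -natrX mulnn.
Qed.

(** A pair disjoint in the first [k] digits but not coprime shares a prime of index l >= k, which is
    at least l + 2 and so exceeds [k]. *)
Lemma coprime_stat_dform x :
  coprime_stat R x <= dform (emp R (xcode x)) (emp R (xcode x)) <=
  coprime_stat R x + nshare R k x / n%:R ^+ 2.
Proof.
have n2 : 0 < n%:R ^+ 2 :> R by rewrite exprn_gt0.
rewrite dform_emp /coprime_stat /nshare -mulrDl !ler_pM2r ?invr_gt0 //.
rewrite -big_split /=; apply/andP; split; apply: ler_sum => i _; last rewrite -big_split /=;
  apply: ler_sum => j _; rewrite !ffunE -?natrD ler_nat.
  case: (coprime_nth_prime (ltn0Sn (x i)) (ltn0Sn (x j))) => // h.
  by rewrite (_ : disj _ _) //; apply/forallP => l; rewrite !ffunE.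
case: (boolP (disj _ _)) => // /forallP h.
case: (coprime_nth_prime (ltn0Sn (x i)) (ltn0Sn (x j))) => //= /existsNP[l /negP].
rewrite negbK => /andP[li lj].
rewrite (_ : share k (x i) (x j)) //; apply/existsP.
have ln : (nth_prime l < n.+1)%N.
  by rewrite ltnS; apply: leq_trans (dvdn_leq (ltn0Sn _) li) (ltn_ord _).
exists (Ordinal ln); rewrite /= li lj !andbT.
have [lk|kl] := ltnP l k; last by apply: leq_trans (nth_prime_ge l); lia.
by have := h (Ordinal lk); rewrite !ffunE /= li lj.
Qed.

Lemma sum_xcode (G : pred {ffun 'I_n -> bitvec k}) :
  (\sum_x (G (xcode x))%:R) / n%:R ^+ n =
  \sum_(y | G y) \prod_i dfreq R n (y i).
Proof.
rewrite /xcode (sum_ffun_comp (fun a : 'I_n => dcode k a.+1) (fun y => (G y)%:R)).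
rewrite mulr_suml [RHS]big_mkcond; apply: eq_bigr => y _.
case: (G y); last by rewrite !mul0r.
rewrite mul1r /dfreq -[X in n%:R ^+ X](card_ord n) -prodr_const -prodf_div.
by [].
Qed.

Lemma dist_dform (p q : bitvec k -> R) : prob_vec p -> prob_vec q ->
  `|dform p p - dform q q| <= 2 * \sum_b `|p b - q b|.
Proof.
move=> [p0 p1] [q0 q1].
have -> : 2 * \sum_b `|p b - q b| = \sum_b \sum_b' (`|p b - q b| * p b' + q b * `|p b' - q b'|).
  under [RHS]eq_bigr do rewrite big_split /= -!mulr_sumr p1 mulr1.
  by rewrite big_split /= -mulr_suml q1 mul1r mulr_natl mulr2n.
rewrite /dform /form -sumrB; apply: (le_trans (ler_norm_sum _ _ _)); apply: ler_sum => b _.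
rewrite -sumrB; apply: (le_trans (ler_norm_sum _ _ _)); apply: ler_sum => b' _.
rewrite -mulrBl normrM; apply: (@le_trans _ _ `|p b * p b' - q b * q b'|).
  by rewrite ler_piMr // normr_nat; case: disj; rewrite ?ler01.
have -> : p b * p b' - q b * q b' = (p b - q b) * p b' + q b * (p b' - q b') by ring.
by apply: (le_trans (ler_normD _ _)); rewrite !normrM (ger0_norm (p0 _)) (ger0_norm (q0 _)).
Qed.

Lemma dist_dform_near (p : bitvec k -> R) d (y : {ffun 'I_n -> bitvec k}) : prob_vec p -> near_emp p d y ->
  `|dform (emp R y) (emp R y) - dform p p| <= 2 * #|{: bitvec k}|%:R * d.
Proof.
move=> hp /forallP ny; apply: (le_trans (dist_dform (prob_vec_emp R (ltn0Sn n0) y) hp)).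
rewrite -mulrA ler_pM2l //; apply: (@le_trans _ _ (\sum_(b : bitvec k) d)).
  by apply: ler_sum => b _; exact: ny.
by rewrite sumr_const mulr_natl.
Qed.

End Statistic.

(** * Estimates for large n *)

Section Asymptotics.
Variable R : realType.

Lemma expR_ge_near (e X : R) : 0 < e -> \forall n \near \oo, X <= expR (e * n.+1%:R).
Proof.
move=> e0; near=> n; apply: (@le_trans _ _ (1 + e * n.+1%:R)); last exact: expR_ge1Dx.
apply: (@le_trans _ _ (e * n.+1%:R)); last lra.
rewrite mulrC -ler_pdivrMr //; apply: (@le_trans _ _ n%:R); last by rewrite ler_nat.
near: n; exact: nbhs_infty_ger.
Unshelve. all: by end_near. Qed.

Lemma poly_le_expR_near (a : nat) (e X : R) : 0 < e -> 0 <= X ->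
  \forall n \near \oo, X * n.+2%:R ^+ a <= expR (e * n.+1%:R).
Proof.
move=> e0 X0; pose h := e / (2 * a.+1%:R).
have h0 : 0 < h by rewrite divr_gt0 // mulr_gt0.
have e20 : 0 < e / 2 by rewrite divr_gt0.
have C0 : 0 <= 2 / h by rewrite divr_ge0 // ltW.
apply: filterS (expR_ge_near (X * (2 / h) ^+ a) e20) => n hn.
have n2 : n.+2%:R <= 2 / h * expR (h * n.+1%:R).
  apply: (@le_trans _ _ (2 * n.+1%:R)); first by rewrite -natrM ler_nat; lia.
  rewrite -mulrA ler_pM2l // -ler_pdivrMl ?invr_gt0 // invrK.
  by have := @expR_ge1Dx R (h * n.+1%:R); lra.
apply: (@le_trans _ _ (X * (2 / h * expR (h * n.+1%:R)) ^+ a)).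
  by rewrite ler_wpM2l // lerXn2r ?nnegrE // mulr_ge0 ?expR_ge0.
rewrite exprMn mulrA -expRM_natl.
apply: (@le_trans _ _ (expR (e / 2 * n.+1%:R) * expR (e / 2 * n.+1%:R))); last first.
  by rewrite -expRD ler_expR; lra.
apply: ler_pM; rewrite ?expR_ge0 ?mulr_ge0 ?exprn_ge0 //.
rewrite ler_expR mulrA ler_wpM2r // /h.
rewrite mulrA ler_pdivrMr ?mulr_gt0 //.
have -> : e / 2 * (2 * a.+1%:R) = e * a.+1%:R by field.
by rewrite mulrC ler_pM2l // ler_nat.
Qed.

(** With ln k at least 4 (|L| + 2)/c the exponent is at least n (|L| + 2), and the 2 absorbs the
    entropy factor n 2^n <= exp (2n). *)
Lemma nshare_tail_near (c L : R) : 0 < c -> exists K, forall k, (K <= k)%N ->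
  \forall n \near \oo,
    (\sum_(x : {ffun 'I_n.+1 -> 'I_n.+1}) (c * n.+1%:R ^+ 2 < nshare R k x)%R%:R)
      / n.+1%:R ^+ n.+1 <= expR (- (n.+1%:R * L)) :> R.
Proof.
move=> c0; pose l := 4 * (`|L| + 2) / c.
have l0 : 0 < l by rewrite divr_gt0 // mulr_gt0 // ltr_wpDl.
exists (Num.truncn (expR l)).+1 => k Kk.
have k0 : (0 < k)%N by exact: leq_trans Kk.
have lk : l <= ln k%:R.
  rewrite -[leLHS]expRK ler_ln ?posrE ?expR_gt0 ?ltr0n //.
  by apply: (le_trans (ltW (truncnS_gt _))); rewrite ler_nat.
near=> n; have nR : 0 < n.+1%:R :> R by [].
rewrite ler_pdivrMr ?exprn_gt0 //; apply: (le_trans (nshare_tail n c k0)).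
rewrite mulrC ler_pM2r ?exprn_gt0 //.
have n1 : n.+1%:R <= expR n.+1%:R :> R by have := @expR_ge1Dx R n.+1%:R; lra.
have n2 : 2 ^+ n.+1 <= expR n.+1%:R :> R.
  rewrite -[X in expR X]mulr1 expRM_natl lerXn2r ?nnegrE ?expR_ge0 //.
  by have := @expR_ge1Dx R 1; lra.
apply: (@le_trans _ _ (expR n.+1%:R * expR n.+1%:R * expR (- ((c * n.+1%:R - 1) / 2 * ln k%:R)))).
  by rewrite ler_wpM2r ?expR_ge0 // ler_pM // exprn_ge0.
rewrite -!expRD ler_expR.
have cn : c * n.+1%:R / 4 <= (c * n.+1%:R - 1) / 2.
  have : 2 <= c * n.+1%:R.
    rewrite mulrC -ler_pdivrMr //; apply: (@le_trans _ _ n%:R); last by rewrite ler_nat.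
    by near: n; exact: nbhs_infty_ger.
  by set z := c * _; lra.
have : c * n.+1%:R / 4 * l <= (c * n.+1%:R - 1) / 2 * ln k%:R.
  by apply: ler_pM => //; [rewrite divr_ge0 // mulr_ge0 // ltW | exact: ltW].
have -> : c * n.+1%:R / 4 * l = n.+1%:R * (`|L| + 2).
  by rewrite /l; field; rewrite gt_eqF.
have : n.+1%:R * L <= n.+1%:R * `|L| by rewrite ler_pM2l // ler_norm.
lra.
Unshelve. all: by end_near. Qed.

Lemma dfreq_near k (e : R) : 0 < e -> \forall n \near \oo, forall b : bitvec k,
  expR (- e) * dlaw R b <= dfreq R n.+1 b <= expR e * dlaw R b.
Proof.
move=> e0; have E : 1 < expR e by rewrite expR_gt1.
have E' : expR (- e) < 1 by rewrite expRN invf_lt1 ?expR_gt0.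
suff : \forall n \near \oo, forall b : bitvec k, b \in enum {: bitvec k} ->
    expR (- e) * dlaw R b <= dfreq R n.+1 b <= expR e * dlaw R b.
  by apply: filterS => n h b; apply: h; rewrite mem_enum.
elim: (enum _) => [|b s ih]; first by apply: nearW.
have cb : dfreq R n.+1 b @[n --> \oo] --> dlaw R b.
  by have := @cvg_dfreq R k b; rewrite -(cvg_shiftS (fun n => dfreq R n b)).
have d0 := dlaw_gt0 R b.
near=> n => c; rewrite inE => /predU1P[->|cs].
  apply/andP; split; apply/ltW; near: n.
    apply: (cvgr_gt _ cb); nra.
  apply: (cvgr_lt _ cb); nra.
by move: c cs; near: n.
Unshelve. all: by end_near. Qed.

End Asymptotics.

(** * Exponential bounds for the law of the statistic *)

Section LDPBounds.
Variable R : realType.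
Local Notation dlaw := (@dlaw R).

Definition tail k n (c : R) : R :=
  (\sum_(x : {ffun 'I_n.+1 -> 'I_n.+1}) (c * n.+1%:R ^+ 2 < nshare R k x)%R%:R) / n.+1%:R ^+ n.+1.

Lemma coprime_stat_near k n (c : R) (x : {ffun 'I_n.+1 -> 'I_n.+1}) :
  ~~ (c * n.+1%:R ^+ 2 < nshare R k x)%R ->
  `|coprime_stat R x - dform (emp R (xcode k x)) (emp R (xcode k x))| <= c.
Proof.
rewrite -leNgt => h; have /andP[h1 h2] := coprime_stat_dform R k x.
have n2 : 0 < n.+1%:R ^+ 2 :> R by rewrite exprn_gt0.
have : nshare R k x / n.+1%:R ^+ 2 <= c by rewrite ler_pdivrMr.
set v := _ / _ in h2 *; rewrite ler_norml; lra.
Qed.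

Lemma Pn_le k n (c : R) (A : set R) (G : pred {ffun 'I_n.+1 -> bitvec k}) :
  (forall y s, A s -> `|s - dform (emp R y) (emp R y)| <= c -> G y) ->
  Pn n.+1 A <= \sum_(y | G y) \prod_i dfreq R n.+1 (y i) + tail k n c.
Proof.
move=> hG; rewrite -sum_xcode /tail -mulrDl /Pn ler_wpM2r ?invr_ge0 ?exprn_ge0 //.
rewrite -big_split /=; apply: ler_sum => x _; case: asboolP => Ax; last by rewrite addr_ge0.
case: (boolP (_ < _)%R) => hx; first by rewrite lerDr.
by rewrite (hG _ _ Ax (coprime_stat_near hx)) addr0.
Qed.

Lemma Pn_ge k n (c : R) (A : set R) (G : pred {ffun 'I_n.+1 -> bitvec k}) :
  (forall y s, I01 s -> G y -> `|s - dform (emp R y) (emp R y)| <= c -> A s) ->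
  \sum_(y | G y) \prod_i dfreq R n.+1 (y i) - tail k n c <= Pn n.+1 A.
Proof.
move=> hG; rewrite -sum_xcode /tail -mulrBl /Pn ler_wpM2r ?invr_ge0 ?exprn_ge0 //.
rewrite -sumrB; apply: ler_sum => x _.
case: (boolP (_ < _)%R) => hx.
  apply: (@le_trans _ _ 0); first by rewrite subr_le0 ler_nat; case: (G _).
  by case: asboolP.
rewrite subr0; case: (boolP (G _)) => Gx; last by case: asboolP.
by case: asboolP => // -[]; apply: hG Gx (coprime_stat_near hx); exact: coprime_stat_I01.
Qed.

Lemma absorb_poly (E B W : R) : 0 < E -> 0 < B -> 0 <= W -> 2 * W <= E -> 2 <= E ->
  E * (W * (B / (E * E * E))) <= B / 2.
Proof.
move=> E0 B0 W0 WE E2.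
have -> : E * (W * (B / (E * E * E))) = (2 * W / E) * (B / E) / 2 by field; rewrite gt_eqF.
rewrite ler_pM2r ?invr_gt0 // -[leRHS]mul1r; apply: ler_pM.
- by rewrite divr_ge0 ?(ltW E0) // mulr_ge0.
- by rewrite divr_ge0 // ltW.
- by rewrite ler_pdivrMr // mul1r.
- by rewrite ler_pdivrMr // ler_peMr ?(ltW B0) //; lra.
Qed.

(** The margin above [t] absorbs, at scale [E = expR (e * n.+1)], the passage from digit frequencies
    to [dlaw] and the polynomial number of types; the truncation error decays at rate [t + e]. Each
    part ends below half of the target. *)
Lemma Pn_upper (t e : R) K (A : set R) : 0 < e ->
  (forall k (p : bitvec k -> R) s, (K <= k)%N -> prob_vec p -> A s ->
     `|s - dform p p| <= e -> t + 3 * e <= relent p (@dlaw k)) ->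
  \forall n \near \oo, Pn n.+1 A <= expR (- (n.+1%:R * t)).
Proof.
move=> e0 H; have [K' hK'] := nshare_tail_near (t + e) e0.
pose k := maxn K K'; have nt := hK' k (leq_maxr _ _).
have nd := dfreq_near k e0.
have np := @poly_le_expR_near R #|{: bitvec k}| e 2 e0 (ler0n R 2).
have ne := expR_ge_near 2 e0.
near=> n.
have tl : tail k n e <= expR (- (n.+1%:R * (t + e))) by near: n; exact: nt.
have dn (b : bitvec k) : dfreq R n.+1 b <= expR e * dlaw b.
  by move: b; near: n; apply: filterS nd => n h b; case/andP: (h b).
have pn : 2 * n.+2%:R ^+ #|{: bitvec k}| <= expR (e * n.+1%:R) by near: n; exact: np.
have en : 2 <= expR (e * n.+1%:R) by near: n; exact: ne.
pose G (y : {ffun 'I_n.+1 -> bitvec k}) := `[< exists2 s, A s & `|s - dform (emp R y) (emp R y)| <= e >].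
have hP := @Pn_le k n e A G (fun y s As h => introT (asboolP _) (ex_intro2 _ _ s As h)).
apply: (le_trans hP).
have hG : \sum_(y | G y) \prod_i dlaw (y i) <= n.+2%:R ^+ #|{: bitvec k}| * expR (- (n.+1%:R * (t + 3 * e))).
  apply: sanov_upper => //; first exact: dlaw_gt0.
  move=> y /asboolP[s As hs]; apply: (H k _ s) => //; first exact: leq_maxl.
  exact: prob_vec_emp.
have hQ : \sum_(y | G y) \prod_i dfreq R n.+1 (y i) <= expR (e * n.+1%:R) * \sum_(y | G y) \prod_i dlaw (y i).
  rewrite mulr_sumr; apply: ler_sum => y _.
  rewrite mulrC expRM_natr -[X in _ ^+ X](card_ord n.+1) -prodr_const -big_split /=.
  apply: ler_prod => i _; rewrite divr_ge0 ?sumr_ge0 //=; first by rewrite mulrC dn.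
set E := expR (e * n.+1%:R) in pn en hQ *.
have E0 : 0 < E by exact: expR_gt0.
have e1 : expR (- (n.+1%:R * (t + 3 * e))) = expR (- (n.+1%:R * t)) / (E * E * E).
  by rewrite /E -!expRD -expRN -expRD; congr expR; ring.
have e2 : expR (- (n.+1%:R * (t + e))) = expR (- (n.+1%:R * t)) / E.
  by rewrite /E -expRN -expRD; congr expR; ring.
rewrite e1 in hG; rewrite e2 in tl; set B := expR (- (n.+1%:R * t)) in hG tl *.
have B0 : 0 < B by exact: expR_gt0.
have tl2 : B / E <= B / 2 by rewrite ler_pM2l // lef_pV2 ?posrE.
have main := absorb_poly E0 B0 (exprn_ge0 #|{: bitvec k}| (ler0n R n.+2)) pn en.
have half : E * \sum_(y | G y) \prod_i dlaw (y i) <= B / 2.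
  by apply: le_trans main; rewrite ler_pM2l.
rewrite [leRHS]splitr; apply: lerD; first exact: le_trans half.
exact: le_trans tl2.
Unshelve. all: by end_near. Qed.

(** [c = e / 3] since three errors add up: truncation, empirical law against [p k], and form of
    [p k] against x. Of the entropy gap [4 * h], one [h] covers the fluctuation [d * C], one the
    digit frequencies, and two leave a factor large enough to outweigh 1/2 and the tail. *)
Lemma Pn_lower (t e x : R) (A : set R) (p : forall k, bitvec k -> R) : 0 < e ->
  (forall s, I01 s -> `|s - x| < e -> A s) ->
  (forall k, prob_vec (p k)) -> (forall k, relent (p k) (@dlaw k) < t) ->
  dform (p k) (p k) @[k --> \oo] --> x ->
  \forall n \near \oo, expR (- (n.+1%:R * t)) <= Pn n.+1 A.
Proof.
move=> e0 hA hp pt px; pose c := e / 3.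
have c0 : 0 < c by rewrite divr_gt0.
have [K hK] := nshare_tail_near (t + 1) c0.
have [k Kk pk] : exists2 k, (K <= k)%N & `|x - dform (p k) (p k)| < c.
  have /cvgrPdist_lt/(_ c c0)[M _ hM] := px.
  by exists (maxn K M); [exact: leq_maxl | apply: hM; exact: leq_maxr].
pose h := (t - relent (p k) (@dlaw k)) / 4.
have h0 : 0 < h by rewrite divr_gt0 // subr_gt0.
have th : t = relent (p k) (@dlaw k) + 4 * h by rewrite /h; field.
pose C := \sum_b `|ln (p k b / dlaw b)|.
have C0 : 0 <= C by exact: sumr_ge0.
pose T : R := #|{: bitvec k}|%:R.
have T0 : 0 <= T by [].
pose d := Num.min (h / (C + 1)) (c / (2 * T + 1)).
have d0 : 0 < d by rewrite lt_min !divr_gt0 //; lra.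
have dC : d * C <= h.
  apply: (@le_trans _ _ (h / (C + 1) * C)); first by rewrite ler_wpM2r // ge_min lexx.
  by rewrite mulrAC ler_pdivrMr ?ltr_wpDl // ler_pM2l //; lra.
have dT : 2 * T * d <= c.
  apply: (@le_trans _ _ (2 * T * (c / (2 * T + 1)))).
    by rewrite ler_wpM2l ?mulr_ge0 // ge_min lexx orbT.
  by rewrite mulrA ler_pdivrMr; [nra | lra].
have nt := hK k Kk; have nd := dfreq_near k h0.
have ne := expR_ge_near 4 h0.
have nT : \forall n \near \oo, 2 * T <= n.+1%:R * d ^+ 2.
  near=> n; rewrite -ler_pdivrMr ?exprn_gt0 //; apply: (@le_trans _ _ n%:R); last by rewrite ler_nat.
  by near: n; exact: nbhs_infty_ger.
near=> n.
have tl : tail k n c <= expR (- (n.+1%:R * (t + 1))) by near: n; exact: nt.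
have dn (b : bitvec k) : expR (- h) * dlaw b <= dfreq R n.+1 b.
  by move: b; near: n; apply: filterS nd => n h' b; case/andP: (h' b).
have en : 4 <= expR (h * n.+1%:R) by near: n; exact: ne.
have Tn : 2 * T <= n.+1%:R * d ^+ 2 by near: n; exact: nT.
pose G (y : {ffun 'I_n.+1 -> bitvec k}) := near_emp (p k) d y.
have hP : \sum_(y | G y) \prod_i dfreq R n.+1 (y i) - tail k n c <= Pn n.+1 A.
  apply: Pn_ge => y s Is Gy hs; apply: hA => //.
  have h1 := dist_dform_near (hp k) Gy.
  have -> : s - x = (s - dform (emp R y) (emp R y)) + (dform (emp R y) (emp R y) - dform (p k) (p k))
     + (dform (p k) (p k) - x) by ring.
  apply: (le_lt_trans (ler_normD _ _)); rewrite [`|_ - x|]distrC.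
  have := ler_normD (s - dform (emp R y) (emp R y)) (dform (emp R y) (emp R y) - dform (p k) (p k)).
  have : e = 3 * c by rewrite /c; field.
  by rewrite -/T in h1; lra.
apply: le_trans hP.
have hS := sanov_lower (ltn0Sn n) (hp k) (@dlaw_gt0 R k) d0 Tn; rewrite -/C in hS.
have hQ : expR (- (h * n.+1%:R)) * \sum_(y | G y) \prod_i dlaw (y i) <= \sum_(y | G y) \prod_i dfreq R n.+1 (y i).
  rewrite mulr_sumr; apply: ler_sum => y _.
  rewrite -mulNr mulrC expRM_natr -[X in _ ^+ X](card_ord n.+1) -prodr_const -big_split /=.
  apply: ler_prod => i _; rewrite mulr_ge0 ?expR_ge0 ?(ltW (dlaw_gt0 _ _)) //=.
  by rewrite mulrC dn.
set B := expR (- (n.+1%:R * t)).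
have B0 : 0 < B by exact: expR_gt0.
have tlB : tail k n c <= B.
  apply: (le_trans tl); rewrite ler_expR lerN2 ler_pM2l //; lra.
set E := expR (h * n.+1%:R) in en hQ *.
have E0 : 0 < E by exact: expR_gt0.
have hS2 : 2^-1 * (B * (E * E * E)) <= \sum_(y | G y) \prod_i dlaw (y i).
  apply: le_trans hS; rewrite ler_pM2l ?invr_gt0 // /B /E -!expRD ler_expR.
  have : n.+1%:R * (d * C) <= n.+1%:R * h by rewrite ler_pM2l.
  have -> : relent (p k) (@dlaw k) = t - 4 * h by rewrite /h; field.
  by rewrite mulrDr; nra.
have hS3 : 2^-1 * (B * (E * E)) <= \sum_(y | G y) \prod_i dfreq R n.+1 (y i).
  apply: le_trans hQ; rewrite expRN -/E.
  have Ei : 0 < E^-1 by rewrite invr_gt0.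
  have h2 : E^-1 * (2^-1 * (B * (E * E * E))) <= E^-1 * \sum_(y | G y) \prod_i dlaw (y i).
    by rewrite ler_pM2l.
  apply: le_trans h2; rewrite le_eqVlt; apply/orP; left; apply/eqP.
  by field; rewrite gt_eqF.
have EE : 2 * 2 <= 2^-1 * (E * E) by nra.
rewrite lerBrDr; apply: le_trans hS3; apply: (le_trans (lerD (lexx B) tlB)).
have -> : B + B = B * 2 by ring.
by rewrite mulrCA ler_pM2l //; lra.
Unshelve. all: by end_near. Qed.

End LDPBounds.

(** * The large deviation principle *)

Section LogScale.
Variable R : realType.

Lemma limn_esup_le_near (u : nat -> \bar R) l :
  (\forall n \near \oo, (u n <= l)%E) -> (limn_esup u <= l)%E.
Proof.
move=> h; rewrite /limn_esup; apply: ge_ereal_inf.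
exists (ereal_sup (u @` [set n | (u n <= l)%E])); first by exists [set n | (u n <= l)%E].
by apply: ge_ereal_sup => _ [n /= hn <-].
Qed.

Lemma limn_einf_ge_near (u : nat -> \bar R) l :
  (\forall n \near \oo, (l <= u n)%E) -> (l <= limn_einf u)%E.
Proof.
move=> h; rewrite /limn_einf leeNr; apply: limn_esup_le_near.
by apply: filterS h => n hn; rewrite leeN2.
Qed.

Lemma elog_le n (P t : R) : 0 <= P -> P <= expR (- (n.+1%:R * t)) ->
  ((n.+1%:R^-1)%:E * elog P <= - t%:E)%E.
Proof.
move=> P0 Pt; rewrite /elog; case: eqP => [_|/eqP Pn].
  by rewrite gt0_muleNy ?lte_fin ?invr_gt0 // leNye.
rewrite -EFinM -EFinN lee_fin ler_pdivrMl // mulrN.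
by rewrite -(expRK (- _)) ler_ln ?posrE ?expR_gt0 // lt_def Pn.
Qed.

Lemma elog_ge n (P t : R) : expR (- (n.+1%:R * t)) <= P ->
  (- t%:E <= (n.+1%:R^-1)%:E * elog P)%E.
Proof.
move=> Pt; have P0 : 0 < P by apply: lt_le_trans Pt; exact: expR_gt0.
rewrite /elog gt_eqF // -EFinM -EFinN lee_fin ler_pdivlMl // mulrN.
by rewrite -(expRK (- _)) ler_ln ?posrE ?expR_gt0.
Qed.

Lemma le_oppe_of_lt (L c : \bar R) : (0 <= c)%E ->
  (forall t : R, (t%:E < c)%E -> (L <= - t%:E)%E) -> (L <= - c)%E.
Proof.
move=> c0 H; case: c c0 H => [c| |] // c0 H.
  apply/lee_addgt0Pr => e e0; have := H (c - e); rewrite lte_fin => /(_ ltac:(lra)).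
  by rewrite -!EFinN -EFinD opprB addrC.
rewrite leeNy_eq; apply/eqP; case: L H => [l| |] // H.
  by exfalso; have := H (- l + 1)%R (ltry _); rewrite -EFinN lee_fin; lra.
by have := H 0 (ltry _); rewrite leye_eq.
Qed.

Lemma Pn_ge0 n (A : set R) : 0 <= Pn n A.
Proof. by rewrite divr_ge0 ?exprn_ge0 // sumr_ge0 // => x _; case: ifP. Qed.

End LogScale.

(** * Lower and upper bounds of the principle *)

Section MainBounds.
Variables (R : realType) (nu : probability R R).
Hypothesis hnu : is_prime_digit_measure nu.

Lemma ereal_inf_rate_ge0 (B : set R) : (0 <= ereal_inf (rate_I1 nu @` B))%E.
Proof. by apply: le_ereal_inf_tmp => _ [x _ <-]; exact: rate_I1_ge0. Qed.

Lemma ldp_lower (A : set R) :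
  (- ereal_inf (rate_I1 nu @` rel_interior A) <=
   limn_einf (fun n => (n.+1%:R^-1)%:E * elog (Pn n.+1 A)))%E.
Proof.
rewrite leeNl; apply: le_ereal_inf_tmp => _ [x [Ix [e [e0 hA]]] <-].
rewrite leNgt; apply/negP => hlt.
case: (rate_I1 nu x) (rate_I1_ge0 hnu x) hlt (@rate_I1_lt R nu hnu x) => [r| |] //= _ hlt hr; last first.
  by rewrite ltNge leey in hlt.
have [t rt tl] : exists2 t : R, r < t & (t%:E < - limn_einf (fun n => (n.+1%:R^-1)%:E * elog (Pn n.+1 A)))%E.
  case: (- _)%E hlt => [s| |] //; last by exists (r + 1); rewrite ?ltry ?ltrDl.
  by rewrite lte_fin => rs; exists ((r + s) / 2); rewrite ?lte_fin; lra.
have [_ [p [hp pt px]]] := hr t ltac:(by rewrite lte_fin).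
have hA' s : I01 s -> `|s - x| < e -> A s by exact: hA.
have := Pn_lower e0 hA' hp pt px => hn.
have : (- t%:E <= limn_einf (fun n => (n.+1%:R^-1)%:E * elog (Pn n.+1 A)))%E.
  by apply: limn_einf_ge_near; apply: filterS hn => n hn; exact: elog_ge.
by rewrite leeNl leNgt tl.
Qed.

(* If arbitrarily long digit laws of entropy at most t come close to A, a
   cluster point of the nearby values in A violates t < inf I. *)
Lemma separation (A : set R) (t : R) : A `<=` @I01 R ->
  (t%:E < ereal_inf (rate_I1 nu @` rel_closure A))%E ->
  exists e K, 0 < e /\ forall k (p : bitvec k -> R) s, (K <= k)%N -> prob_vec p -> A s ->
     `|s - dform p p| <= e -> t + 3 * e <= relent p (@dlaw R k).
Proof.
move=> AI tI; apply: contrapT => H.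
have {}H m : exists s, A s /\ exists k (p : bitvec k -> R), [/\ (m <= k)%N, prob_vec p,
    `|s - dform p p| <= m.+1%:R^-1 & relent p (@dlaw R k) < t + 3 * m.+1%:R^-1].
  apply: contrapT => H'; apply: H; exists m.+1%:R^-1, m; split; first by rewrite invr_gt0.
  move=> k p s mk hp As sp; rewrite leNgt; apply/negP => rp; apply: H'.
  by exists s; split => //; exists k, p.
have [s hs] := choice H.
have cI : compact (@I01 R).
  have -> : @I01 R = `[0, 1]%classic by apply/seteqP; split => x; rewrite /= in_itv.
  exact: segment_compact.
have sI : (s @ \oo) (@I01 R) by exists 0%N => // m _; apply: AI; exact: (hs m).1.
have [x [Ix xs]] := cI _ _ sI.
have xm e N : 0 < e -> exists2 m, (N <= m)%N & `|s m - x| < e.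
  move=> e0; have [y [/= [m Nm <-] xy]] := xs (s @` [set m | (N <= m)%N]) (ball x e)
    ltac:(by exists N => // m Nm; exists m) (nbhsx_ballx x e e0).
  by exists m => //; rewrite distrC.
have xA : rel_closure A x.
  split => // e e0; have [m _ sm] := xm e 0 e0.
  by exists (s m); split => //; [apply: AI|]; exact: (hs m).1.
have xt : (rate_I1 nu x <= t%:E)%E.
  apply: approximable_rate_I1 => // e N e0.
  (* A quarter, because the entropy excess along the sequence is 3/(m + 1). *)
  have e4 : 0 < e / 4 by rewrite divr_gt0.
  have [m hm sm] := xm (e / 4) (maxn N (Num.truncn (e / 4)^-1)) e4.
  have me : m.+1%:R^-1 <= e / 4.
    rewrite invf_ple ?posrE //; apply: (le_trans (ltW (truncnS_gt _))).
    by rewrite ler_nat ltnS; apply: leq_trans hm; exact: leq_maxr.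
  have [_ [k [p [mk hp sp rp]]]] := hs m.
  set v := m.+1%:R^-1 in me sp rp.
  exists k, p; split => //; first by apply: leq_trans mk; apply: leq_trans hm; exact: leq_maxl.
    by lra.
  have -> : dform p p - x = (dform p p - s m) + (s m - x) by ring.
  by apply: (le_trans (ler_normD _ _)); rewrite [`|_ - s m|]distrC; lra.
have : (ereal_inf (rate_I1 nu @` rel_closure A) <= t%:E)%E.
  by apply: ge_ereal_inf; exists (rate_I1 nu x) => //; exists x.
by rewrite leNgt tI.
Qed.

Lemma ldp_upper (A : set R) : A `<=` @I01 R ->
  (limn_esup (fun n => (n.+1%:R^-1)%:E * elog (Pn n.+1 A)) <=
   - ereal_inf (rate_I1 nu @` rel_closure A))%E.
Proof.
move=> AI; apply: le_oppe_of_lt; first exact: ereal_inf_rate_ge0.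
move=> t tI; have [e [K [e0 hK]]] := separation AI tI.
apply: limn_esup_le_near; apply: filterS (Pn_upper e0 hK) => n.
by apply: elog_le; exact: Pn_ge0.
Qed.

End MainBounds.

Theorem theorem2p2 (R : realType) (nu : probability R R) :
  is_prime_digit_measure nu ->
  LDP (@Pn R) (rate_I1 nu).
Proof.
move=> hnu; split.
- by move=> x _; exact: rate_I1_ge0.
- by move=> t; exact: closed_rate_I1.
- by move=> A _ AI; split; [exact: ldp_lower | exact: ldp_upper].
Qed.
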